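(* Let $K$ be an infinite field of characteristic different from $2$. Let $B=K\oplus V$ be the Jordan algebra of a nondegenerate symmetric bilinear form on a $K$-vector space $V$ with $\dim V=\infty$, and let $B_n=K\oplus V_n$ be the Jordan algebra of a nondegenerate symmetric bilinear form on a $K$-vector space $V_n$ with $\dim V_n=n$, $n\ge1$. Endow $B$ and $B_n$ with the scalar $\mathbb{Z}_2$-grading: $B^{(0)}=K$, $B^{(1)}=V$, respectively $B_n^{(0)}=K$, $B_n^{(1)}=V_n$. 1. The ideal of the graded identities of $B$ coincides with the graded T-ideal generated by the polynomial $(y,x_1,x_2)$. 2. The ideal of the graded identities of $B_n$ is generated, as a graded T-ideal, by $(y,x_1,x_2)$ and $$g_n=\sum_{\sigma\in S_{n+1}}(-1)^\sigma z_{\sigma(1)}(z_{n+2}z_{\sigma(2)})\cdots(z_{2n+1}z_{\sigma(n+1)}).$$ 3. Let $J$ be the Jordan algebra of the symmetric $2\times2$ matrices over $K$ with product $\tfrac12(uv+vu)$ and the scalar grading $J_0=\mathrm{span}(e_{11}+e_{22})$, $J_1=\mathrm{span}(e_{11}-e_{22},\,e_{12}+e_{21})$. The graded identities of $J$ follow (as graded identities) from $(y,x_1,x_2)$ and $$\sum_{\sigma\in S_3}(-1)^\sigma z_{\sigma(1)}(z_4z_{\sigma(2)})(z_5z_{\sigma(3)}).$$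
   Context: Given a symmetric bilinear form $\langle\cdot,\cdot\rangle$ on $V$, the Jordan algebra of the form is $K\oplus V$ with product $(\alpha+u)(\beta+v)=(\alpha\beta+\langle u,v\rangle)+(\alpha v+\beta u)$. All algebras are unital. $(a,b,c)=(ab)c-a(bc)$ is the associator. $X=Y\cup Z$ is the disjoint union of the infinite sets $Y=\{y_1,y_2,\dots\}$ (even variables) and $Z=\{z_1,z_2,\dots\}$ (odd variables), and $J(X)$ is the free unital Jordan algebra over $K$ on $X$, $\mathbb{Z}_2$-graded: a monomial is even if its total degree in the variables from $Z$ is even, and odd otherwise. The letter $y$ denotes an even variable, $z$ an odd variable, and $x$ an arbitrary variable, even or odd (so $(y,x_1,x_2)$ stands for all polynomials obtained by every choice of parities of $x_1,x_2$). A polynomial in $J(X)$ is a graded identity of a graded Jordan algebra $A=A_0\oplus A_1$ if it vanishes whenever the even variables are replaced by elements of $A_0$ and the odd variables by elements of $A_1$. A graded T-ideal is an ideal of $J(X)$ closed under all endomorphisms of $J(X)$ respecting the grading; a graded identity follows from a set of polynomials if it lies in the graded T-ideal generated by them. $(-1)^\sigma$ is the sign of $\sigma$. Products of several factors without parentheses are read as left normed. *)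

(* Defs.v *)
From HB Require Import structures.
From mathcomp Require Import all_boot all_order all_algebra all_fingroup.
From mathcomp Require Import sesquilinear generic_quotient.
From mathcomp Require Import boolp classical_sets cardinality.
From mathcomp Require Import ring ssrAC.

Set Implicit Arguments.
Unset Strict Implicit.
Unset Printing Implicit Defensive.

Import GRing.Theory.
Local Open Scope classical_set_scope.
Local Open Scope ring_scope.
Local Open Scope quotient_scope.

HB.mixin Record isJordanAlg (K : fieldType) A of GRing.Lmodule K A := {
  jone : A;
  jmul : A -> A -> A;
  jmulC : commutative jmul;
  jmulPl : forall (a : K) u v w, jmul (a *: u + v) w = a *: jmul u w + jmul v w;
  jmul1l : left_id jone jmul;
  jordan_identity :
    forall u v, jmul (jmul (jmul u u) v) u = jmul (jmul u u) (jmul v u)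
}.

#[short(type="jordanAlgType")]
HB.structure Definition JordanAlg (K : fieldType) :=
  {A of GRing.Lmodule K A & isJordanAlg K A}.

Declare Scope jordan_scope.
Delimit Scope jordan_scope with J.
Local Open Scope jordan_scope.

Notation "u ** v" := (jmul u v) (at level 40, left associativity) : jordan_scope.

Definition associator (K : fieldType) (A : jordanAlgType K) (u v w : A) : A :=
  (u ** v) ** w - u ** (v ** w).

Definition jordan_hom (K : fieldType) (A B : jordanAlgType K)
    (f : {linear A -> B}) : Prop :=
  f jone = jone /\ {morph f : u v / u ** v}.

Section LinearSpan.
Variables (K : fieldType) (V : lmodType K).

Definition subspace (W : set V) : Prop :=
  W 0 /\ forall (a : K) u v, W u -> W v -> W (a *: u + v).

Definition lspan (S : set V) : set V := smallest subspace S.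

Definition infinite_dimensional : Prop :=
  ~ exists s : seq V, lspan [set` s] = setT.

Definition nondegenerate_form (b : {symmetric V}) : Prop :=
  forall u, (forall v, b u v = 0) -> u = 0.

Lemma lspan_subspace (S : set V) : subspace (lspan S).
Proof.
split=> [W [[]]//|a u v Su Sv W [sW SW]]; apply: sW.2.
- exact: Su.
- exact: Sv.
Qed.

Lemma sub_lspan (S : set V) : S `<=` lspan S.
Proof. by move=> u Su W [_]; apply. Qed.

Lemma lspan_ind (S W : set V) : subspace W -> S `<=` W -> lspan S `<=` W.
Proof. by move=> sW SW u; apply. Qed.

End LinearSpan.

Section Gradings.
Variables (K : fieldType) (A : jordanAlgType K).

(* [G false] is the even component and [G true] the odd one. *)
Definition is_z2grading (G : bool -> set A) : Prop :=
  [/\ forall a, subspace (G a),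
      forall u, exists v w, [/\ G false v, G true w & u = v + w],
      forall u, G false u -> G true u -> u = 0 &
      forall a b u v, G a u -> G b v -> G (a (+) b) (u ** v)].

Lemma lspan_mul (S T W : set A) : subspace W ->
  (forall u v, S u -> T v -> W (u ** v)) ->
  forall u v, lspan S u -> lspan T v -> W (u ** v).
Proof.
move=> [W0 WP] STW u v Su Tv.
have j0 w : 0 ** w = 0 :> A.
  by have := jmulPl (-1) 0 0 w; rewrite scaler0 addr0 scaleN1r addNr.
apply: (lspan_ind (W := [set u | W (u ** v)])) Su.
  split=> [|a x y Wx Wy] /=; first by rewrite j0.
  by rewrite jmulPl; exact: WP.
move=> x Sx; apply: (lspan_ind (W := [set v | W (x ** v)])) Tv.
  split=> [|a y z Wy Wz] /=; first by rewrite jmulC j0.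
  by rewrite jmulC jmulPl ![_ ** x]jmulC; exact: WP.
by move=> y Ty; exact: STW.
Qed.

End Gradings.

(* The free unital Jordan algebra on [X]: terms modulo the congruence generated
   by the axioms of unital Jordan algebras over [K].  The opposite of [t] is
   [JScale (-1) t].                                                           *)
Inductive jterm (K X : Type) :=
| JGen of X
| JZero
| JOne
| JAdd of jterm K X & jterm K X
| JScale of K & jterm K X
| JMul of jterm K X & jterm K X.

Arguments JGen {K X}.
Arguments JZero {K X}.
Arguments JOne {K X}.

Inductive jterm_eq (K : fieldType) (X : Type) : jterm K X -> jterm K X -> Prop :=
| jeq_refl s : jterm_eq s s
| jeq_sym s t : jterm_eq s t -> jterm_eq t s
| jeq_trans s t u : jterm_eq s t -> jterm_eq t u -> jterm_eq s u
| jeq_add s s' t t' :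
    jterm_eq s s' -> jterm_eq t t' -> jterm_eq (JAdd s t) (JAdd s' t')
| jeq_scale a s s' : jterm_eq s s' -> jterm_eq (JScale a s) (JScale a s')
| jeq_mul s s' t t' :
    jterm_eq s s' -> jterm_eq t t' -> jterm_eq (JMul s t) (JMul s' t')
| jeq_addA s t u : jterm_eq (JAdd s (JAdd t u)) (JAdd (JAdd s t) u)
| jeq_addC s t : jterm_eq (JAdd s t) (JAdd t s)
| jeq_add0 s : jterm_eq (JAdd JZero s) s
| jeq_addN s : jterm_eq (JAdd (JScale (-1) s) s) JZero
| jeq_scaleA a b s : jterm_eq (JScale a (JScale b s)) (JScale (a * b) s)
| jeq_scale1 s : jterm_eq (JScale 1 s) s
| jeq_scaleDr a s t :
    jterm_eq (JScale a (JAdd s t)) (JAdd (JScale a s) (JScale a t))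
| jeq_scaleDl a b s :
    jterm_eq (JScale (a + b) s) (JAdd (JScale a s) (JScale b s))
| jeq_mulC s t : jterm_eq (JMul s t) (JMul t s)
| jeq_mulDl s t u : jterm_eq (JMul (JAdd s t) u) (JAdd (JMul s u) (JMul t u))
| jeq_mulZl a s t : jterm_eq (JMul (JScale a s) t) (JScale a (JMul s t))
| jeq_mul1 s : jterm_eq (JMul JOne s) s
| jeq_jordan s t :
    jterm_eq (JMul (JMul (JMul s s) t) s) (JMul (JMul s s) (JMul t s)).

HB.instance Definition _ K X := gen_eqMixin (jterm K X).
HB.instance Definition _ K X := gen_choiceMixin (jterm K X).

Section FreeJordan.
Variables (K : fieldType) (X : Type).

Definition jterm_eqb (s t : jterm K X) : bool := `[< jterm_eq s t >].

Fact jterm_eqb_refl : reflexive jterm_eqb.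
Proof. by move=> s; apply/asboolP; exact: jeq_refl. Qed.

Fact jterm_eqb_sym : symmetric jterm_eqb.
Proof. by move=> s t; apply/asboolP/asboolP; exact: jeq_sym. Qed.

Fact jterm_eqb_trans : transitive jterm_eqb.
Proof.
by move=> t s u /asboolP st /asboolP tu; apply/asboolP; exact: jeq_trans tu.
Qed.

Canonical jterm_equiv :=
  EquivRel jterm_eqb jterm_eqb_refl jterm_eqb_sym jterm_eqb_trans.

Definition free_jordan : Type := {eq_quot jterm_equiv}.

HB.instance Definition _ := Choice.on free_jordan.
HB.instance Definition _ := EqQuotient.on free_jordan.

Fact pi_eq (s t : jterm K X) : jterm_eq s t ->
  \pi_free_jordan s = \pi_free_jordan t.
Proof. by move=> st; apply/eqmodP/asboolP. Qed.

Fact eq_pi (s t : jterm K X) :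
  \pi_free_jordan s = \pi_free_jordan t -> jterm_eq s t.
Proof. by move=> /eqmodP/asboolP. Qed.

Definition fj_gen (x : X) : free_jordan := \pi_free_jordan (JGen x).
Definition fj_zero : free_jordan := \pi_free_jordan JZero.
Definition fj_one : free_jordan := \pi_free_jordan JOne.
Definition fj_add := lift_op2 free_jordan (@JAdd K X).
Definition fj_scale (a : K) := lift_op1 free_jordan (@JScale K X a).
Definition fj_mul := lift_op2 free_jordan (@JMul K X).

Fact fj_repr_pi (s : jterm K X) : jterm_eq (repr (\pi_free_jordan s)) s.
Proof. by apply: eq_pi; rewrite reprK. Qed.

Fact fj_addE s t :
  fj_add (\pi_free_jordan s) (\pi_free_jordan t) = \pi_free_jordan (JAdd s t).
Proof. by unlock fj_add; apply: pi_eq; apply: jeq_add; exact: fj_repr_pi. Qed.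

Fact fj_scaleE a s :
  fj_scale a (\pi_free_jordan s) = \pi_free_jordan (JScale a s).
Proof. by unlock fj_scale; apply: pi_eq; apply: jeq_scale; exact: fj_repr_pi. Qed.

Fact fj_mulE s t :
  fj_mul (\pi_free_jordan s) (\pi_free_jordan t) = \pi_free_jordan (JMul s t).
Proof. by unlock fj_mul; apply: pi_eq; apply: jeq_mul; exact: fj_repr_pi. Qed.

Let fjE := (fj_addE, fj_scaleE, fj_mulE).

Fact fj_addA : associative fj_add.
Proof.
elim/quotW=> s; elim/quotW=> t; elim/quotW=> u; rewrite !fjE.
by apply: pi_eq; exact: jeq_addA.
Qed.

Fact fj_addC : commutative fj_add.
Proof.
by elim/quotW=> s; elim/quotW=> t; rewrite !fjE; apply: pi_eq; exact: jeq_addC.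
Qed.

Fact fj_add0 : left_id fj_zero fj_add.
Proof. by elim/quotW=> s; rewrite fjE; apply: pi_eq; exact: jeq_add0. Qed.

Fact fj_addN : left_inverse fj_zero (fj_scale (-1)) fj_add.
Proof. by elim/quotW=> s; rewrite !fjE; apply: pi_eq; exact: jeq_addN. Qed.

HB.instance Definition _ :=
  GRing.isZmodule.Build free_jordan fj_addA fj_addC fj_add0 fj_addN.

Fact fj_scaleA a b (u : free_jordan) :
  fj_scale a (fj_scale b u) = fj_scale (a * b) u.
Proof.
by elim/quotW: u => s; rewrite !fjE; apply: pi_eq; exact: jeq_scaleA.
Qed.

Fact fj_scale1 : left_id 1 fj_scale.
Proof. by elim/quotW=> s; rewrite !fjE; apply: pi_eq; exact: jeq_scale1. Qed.

Fact fj_scaleDr : right_distributive fj_scale +%R.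
Proof.
move=> a; elim/quotW=> s; elim/quotW=> t; rewrite /GRing.add /= !fjE.
by apply: pi_eq; exact: jeq_scaleDr.
Qed.

Fact fj_scaleDl (u : free_jordan) : {morph fj_scale^~ u : a b / a + b}.
Proof.
move=> a b; elim/quotW: u => s.
rewrite [in RHS]/GRing.add /= !fjE.
by apply: pi_eq; exact: jeq_scaleDl.
Qed.

HB.instance Definition _ := GRing.Zmodule_isLmodule.Build K free_jordan
  fj_scaleA fj_scale1 fj_scaleDr fj_scaleDl.

Fact fj_mulC : commutative fj_mul.
Proof.
by elim/quotW=> s; elim/quotW=> t; rewrite !fjE; apply: pi_eq; exact: jeq_mulC.
Qed.

Fact fj_mulPl (a : K) (u v w : free_jordan) :
  fj_mul (a *: u + v) w = a *: fj_mul u w + fj_mul v w.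
Proof.
elim/quotW: u => s; elim/quotW: v => t; elim/quotW: w => r.
rewrite /GRing.add /GRing.scale /= !fjE; apply: pi_eq.
apply: jeq_trans (jeq_mulDl _ _ _) _.
by apply: jeq_add; [exact: jeq_mulZl | exact: jeq_refl].
Qed.

Fact fj_mul1l : left_id fj_one fj_mul.
Proof. by elim/quotW=> s; rewrite !fjE; apply: pi_eq; exact: jeq_mul1. Qed.

Fact fj_jordan (u v : free_jordan) :
  fj_mul (fj_mul (fj_mul u u) v) u = fj_mul (fj_mul u u) (fj_mul v u).
Proof.
elim/quotW: u => s; elim/quotW: v => t; rewrite !fjE; apply: pi_eq.
exact: jeq_jordan.
Qed.

HB.instance Definition _ := isJordanAlg.Build K free_jordan
  fj_mulC fj_mulPl fj_mul1l fj_jordan.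

End FreeJordan.

Section Evaluation.
Variables (K : fieldType) (X : Type) (A : jordanAlgType K) (rho : X -> A).

Fixpoint jterm_eval (t : jterm K X) : A :=
  match t with
  | JGen x => rho x
  | JZero => 0
  | JOne => jone
  | JAdd s t => jterm_eval s + jterm_eval t
  | JScale a s => a *: jterm_eval s
  | JMul s t => jterm_eval s ** jterm_eval t
  end.

Definition fj_eval (u : free_jordan K X) : A := jterm_eval (repr u).

Lemma jterm_evalP s t : jterm_eq s t -> jterm_eval s = jterm_eval t.
Proof.
elim=> {s t} //=; try by move=> *; congruence.
- by move=> *; rewrite addrA.
- by move=> s t; rewrite addrC.
- by move=> *; rewrite add0r.
- by move=> s; rewrite scaleN1r addNr.
- by move=> *; rewrite scalerA.
- by move=> *; rewrite scale1r.
- by move=> *; rewrite scalerDr.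
- by move=> *; rewrite scalerDl.
- by move=> *; exact: jmulC.
- by move=> s t u; have := jmulPl 1 (jterm_eval s) (jterm_eval t) (jterm_eval u);
    rewrite !scale1r.
- move=> a s t.
  have h0 : jmul 0 (jterm_eval t) = 0.
    by have := jmulPl (-1) 0 0 (jterm_eval t);
      rewrite scaler0 addr0 scaleN1r addNr.
  by have := jmulPl a (jterm_eval s) 0 (jterm_eval t); rewrite h0 !addr0.
- by move=> s; exact: jmul1l.
- by move=> s t; exact: jordan_identity.
Qed.

Lemma fj_eval_pi t : fj_eval (\pi_(free_jordan K X) t) = jterm_eval t.
Proof. by apply: jterm_evalP; exact: fj_repr_pi. Qed.

Lemma fj_eval_gen x : fj_eval (fj_gen K x) = rho x.
Proof. exact: fj_eval_pi. Qed.

Lemma fj_eval_linear : linear fj_eval.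
Proof.
move=> a; elim/quotW=> s; elim/quotW=> t.
by rewrite {1}/GRing.add {1}/GRing.scale /= fj_scaleE fj_addE !fj_eval_pi.
Qed.

HB.instance Definition _ :=
  GRing.isLinear.Build K (free_jordan K X) A _ fj_eval fj_eval_linear.

Lemma fj_eval_hom : jordan_hom fj_eval.
Proof.
split; first exact: fj_eval_pi.
elim/quotW=> s; elim/quotW=> t.
by rewrite {1}/jmul /= fj_mulE !fj_eval_pi.
Qed.

Lemma fj_eval_unique (f : {linear free_jordan K X -> A}) :
  jordan_hom f -> (forall x, f (fj_gen K x) = rho x) -> f =1 fj_eval.
Proof.
move=> [f1 fM] fX; elim/quotW=> t; rewrite fj_eval_pi.
elim: t => [x|||s IHs t IHt|a s IHs|s IHs t IHt] /=.
- exact: fX.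
- exact: (linear0 f).
- exact: f1.
- by rewrite -fj_addE -IHs -IHt; exact: (linearD f).
- by rewrite -fj_scaleE -IHs; exact: (linearZ_LR f).
- by rewrite -fj_mulE -IHs -IHt; exact: fM.
Qed.

End Evaluation.

(* [(false, i)] is the even variable y_{i+1}, [(true, i)] the odd variable
   z_{i+1}: the first component is the parity.                                *)
Definition gvar : Type := (bool * nat)%type.

Section GradedIdentities.
Variable K : fieldType.

Definition JX : jordanAlgType K := free_jordan K gvar.

Definition xvar (a : bool) (i : nat) : JX := fj_gen K (a, i).
Definition yvar (i : nat) : JX := xvar false i.
Definition zvar (i : nat) : JX := xvar true i.

Inductive jmonomial : bool -> JX -> Prop :=
| jmonomial_one : jmonomial false jone
| jmonomial_var a i : jmonomial a (xvar a i)
| jmonomial_mul a b u v :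
    jmonomial a u -> jmonomial b v -> jmonomial (a (+) b) (u ** v).

Definition JX_grading (a : bool) : set JX := lspan [set u | jmonomial a u].

Lemma JX_grading_is_grading : 2%N \notin [pchar K] -> is_z2grading JX_grading.
Proof.
move=> char_neq2.
have sJ a : subspace (JX_grading a) := lspan_subspace _.
have JXM a b u v :
    JX_grading a u -> JX_grading b v -> JX_grading (a (+) b) (u ** v).
  apply: lspan_mul => // {}u {}v mu mv.
  by apply: sub_lspan; exact: jmonomial_mul.
have JXD a u v : JX_grading a u -> JX_grading a v -> JX_grading a (u + v).
  by move=> Ju Jv; have := (sJ a).2 1 _ _ Ju Jv; rewrite scale1r.
have JXZ a c u : JX_grading a u -> JX_grading a (c *: u).
  by move=> Ju; have := (sJ a).2 c _ _ Ju (sJ a).1; rewrite addr0.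
split=> //.
- suff dec (t : jterm K gvar) : exists v w,
      [/\ JX_grading false v, JX_grading true w &
          fj_eval (@fj_gen K gvar : gvar -> JX) (\pi_(free_jordan K gvar) t) =
          v + w].
    move=> u; elim/quotW: u => t; have [v [w [Jv Jw e]]] := dec t.
    exists v, w; split=> //; rewrite -e.
    exact: (@fj_eval_unique _ _ JX (@fj_gen K gvar) idfun).
  rewrite fj_eval_pi; elim: t => [[a i]|||s [v [w [Jv Jw e]]] t [v' [w' [Jv' Jw' e']]]
      |c s [v [w [Jv Jw e]]]|s [v [w [Jv Jw e]]] t [v' [w' [Jv' Jw' e']]]] /=.
  + have := sub_lspan (jmonomial_var a i : [set u | jmonomial a u] _).
    case: a => Ja; [exists 0, (xvar true i)|exists (xvar false i), 0];
      by rewrite ?add0r ?addr0; split=> //; exact: (sJ _).1.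
  + by exists 0, 0; rewrite addr0; split=> //; exact: (sJ _).1.
  + exists jone, 0; rewrite addr0; split=> //; last exact: (sJ _).1.
    by apply: sub_lspan; exact: jmonomial_one.
  + by exists (v + v'), (w + w'); rewrite e e' addrACA; split=> //; exact: JXD.
  + by exists (c *: v), (c *: w); rewrite e scalerDr; split=> //; exact: JXZ.
  + exists (v ** v' + w ** w'), (v ** w' + w ** v'); split.
    * by apply: JXD; [exact: (JXM false false) | exact: (JXM true true)].
    * by apply: JXD; [exact: (JXM false true) | exact: (JXM true false)].
    * have jD (x y z : JX) : (x + y) ** z = x ** z + y ** z.
        by have := jmulPl 1 x y z; rewrite !scale1r.
      rewrite e e' jD ![_ ** (v' + w')]jmulC !jD ![v' ** _]jmulC ![w' ** _]jmulC.
      by rewrite [w ** v' + _]addrC addrACA.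
- pose f := fj_eval (fun x : gvar => (-1) ^+ x.1 *: xvar x.1 x.2).
  have fL : linear f := fj_eval_linear _.
  have f0 : f 0 = 0 by exact: linear0.
  have [f1 fM] : f jone = jone /\ {morph f : u v / u ** v} := fj_eval_hom _.
  have fP a u : JX_grading a u -> f u = (-1) ^+ a *: u.
    apply: (lspan_ind (W := [set u | f u = (-1) ^+ a *: u])).
      split=> [|c x y /= fx fy] /=; first by rewrite scaler0 f0.
      by rewrite fL fx fy scalerDr !scalerA mulrC.
    move=> x /=; elim=> {x} [|{}a i|{}a b x y _ fx _ fy].
    + by rewrite f1 expr0 scale1r.
    + exact: fj_eval_gen.
    + rewrite fM fx fy signr_addb.
      have jZ c (v w : JX) : (c *: v) ** w = c *: (v ** w).
        have j0 : 0 ** w = 0 :> JX.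
          by have := jmulPl (-1) 0 0 w; rewrite scaler0 addr0 scaleN1r addNr.
        by have := jmulPl c v 0 w; rewrite j0 !addr0.
      by rewrite jZ jmulC jZ jmulC scalerA.
  move=> u /fP fu0 /fP; rewrite fu0 expr0 expr1 scale1r scaleN1r => /eqP.
  rewrite -addr_eq0 -mulr2n -scaler_nat scaler_eq0 => /orP[|/eqP//].
  by move: char_neq2; rewrite inE /= => /negbTE ->.
Qed.

Definition graded_endomorphism (f : {linear JX -> JX}) : Prop :=
  jordan_hom f /\ forall a u, JX_grading a u -> JX_grading a (f u).

Definition jordan_ideal (I : set JX) : Prop :=
  subspace I /\ forall u v, I u -> I (u ** v).

Definition graded_T_ideal (I : set JX) : Prop :=
  jordan_ideal I /\
  forall f : {linear JX -> JX}, graded_endomorphism f ->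
    forall u, I u -> I (f u).

Definition graded_T_ideal_generated (S : set JX) : set JX :=
  smallest graded_T_ideal S.

Definition graded_identities (A : jordanAlgType K) (G : bool -> set A) :
    set JX :=
  [set f | forall rho : gvar -> A,
     (forall x : gvar, G x.1 (rho x)) -> fj_eval rho f = 0].

(* (y, x_1, x_2) stands for four polynomials in three distinct variables, one
   for each choice of the parities of x_1 and x_2.                            *)
Definition y_associators : set JX :=
  [set u | exists a b : bool,
     u = associator (yvar 0) (xvar a 1) (xvar b 2)].

(* sum over S_{n+1} of
     (-1)^s z_{s(1)} (z_{n+2} z_{s(2)}) (z_{n+3} z_{s(3)}) ... (z_{2n+1} z_{s(n+1)})
   with indices shifted down by one, the product being left normed.           *)
Definition gpoly (n : nat) : JX :=
  \sum_(s : 'S_n.+1) (-1) ^+ s *: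
    foldl (fun (w : JX) (i : 'I_n) =>
             w ** (zvar (n.+1 + i) ** zvar (s (lift ord0 i))))
          (zvar (s ord0)) (enum 'I_n).

End GradedIdentities.

Arguments y_associators K : clear implicits.

(* The phantom argument [b] selects the product on K + V. *)
Definition form_alg (K : fieldType) (V : lmodType K) (b : {symmetric V}) : Type :=
  (K^o * V)%type.

Section FormAlgebra.
Variables (K : fieldType) (V : lmodType K) (b : {symmetric V}).
Notation B := (form_alg b).

HB.instance Definition _ := GRing.Lmodule.on B.

Definition form_one : B := (1, 0).
Definition form_mul (u v : B) : B :=
  (u.1 * v.1 + b u.2 v.2, u.1 *: v.2 + v.1 *: u.2).

Fact form_sym (u v : V) : b u v = b v u.
Proof. by rewrite (hermC b) expr0 mul1r. Qed.

Fact form_mulC : commutative form_mul.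
Proof.
by move=> u v; rewrite /form_mul mulrC form_sym [_ + v.1 *: _]addrC.
Qed.

Fact form_mulPl (a : K) (u v w : B) :
  form_mul (a *: u + v) w = a *: form_mul u w + form_mul v w.
Proof.
case: u v w => [u1 u2] [v1 v2] [w1 w2]; congr pair => /=.
  by rewrite linearPl /=  /GRing.scale /=; ring.
rewrite !scalerDr !scalerDl !scalerA [w1 * a]mulrC.
by rewrite -!addrA; congr (_ + _); rewrite addrCA.
Qed.

Fact form_mul1l : left_id form_one form_mul.
Proof.
by case=> u1 u2; rewrite /form_mul /= linear0l mul1r addr0 scale1r scaler0 addr0.
Qed.

Fact form_jordan (u v : B) :
  form_mul (form_mul (form_mul u u) v) u = form_mul (form_mul u u) (form_mul v u).
Proof.
case: u v => [u1 u2] [v1 v2]; congr pair => /=.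
  rewrite !(linearDl, linearDr, linearZl_LR, linearZr_LR) /= (form_sym v2 u2).
  by ring.
rewrite !(linearDl, linearZl_LR) /= !(scalerDl, scalerDr, scalerA).
rewrite (form_sym v2 u2).
rewrite !addrA [LHS](ACl ((1*2*3*6*7)*(4*5)))%AC.
rewrite [RHS](ACl ((1*3*5*6*7*8)*(2*4)))%AC /= -!scalerDl.
by congr (_ *: _ + _ *: _); rewrite /GRing.scale /=; ring.
Qed.

HB.instance Definition _ := isJordanAlg.Build K B
  form_mulC form_mulPl form_mul1l form_jordan.

Definition scalar_grading (a : bool) : set B :=
  if a then [set u | u.1 = 0] else [set u | u.2 = 0].

Lemma scalar_grading_is_grading : is_z2grading scalar_grading.
Proof.
split.
- by case; split=> //= a u v; [move=> -> -> | move=> -> ->];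
    rewrite ?scaler0 addr0.
- move=> [a u]; exists (a, 0), (0, u); split=> //.
  by congr pair; rewrite /= ?addr0 ?add0r.
- by move=> [a u] /= -> ->.
- move=> [] [] [a u] [c v] /= -> ->;
  by rewrite ?(mul0r, mulr0, scaler0, scale0r, linear0l, linear0r, addr0).
Qed.

End FormAlgebra.

Arguments scalar_grading {K V} b a.

Section SymmetricMatrices.
Variable K : fieldType.

Definition symmx2 : {pred 'M[K]_2} := [pred A | A^T == A].

Fact symmx2_submod_closed : submod_closed symmx2.
Proof.
split=> [|a A B]; rewrite !inE ?trmx0 // => /eqP sA /eqP sB.
by rewrite linearP /= sA sB.
Qed.

HB.instance Definition _ :=
  GRing.isSubmodClosed.Build K 'M[K]_2 symmx2 symmx2_submod_closed.

(* The product is (u v + v u) / 2 only if the characteristic is not 2, whence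
   the phantom argument.                                                      *)
Definition sym2_alg (char_neq2 : 2%N \notin [pchar K]) : Type :=
  {A : 'M[K]_2 | A \in symmx2}.

Variable char_neq2 : 2%N \notin [pchar K].
Notation J := (sym2_alg char_neq2).

HB.instance Definition _ := SubChoice.on J.
HB.instance Definition _ := [SubChoice_isSubZmodule of J by <:].
HB.instance Definition _ := [SubZmodule_isSubLmodule of J by <:].

Fact sym2_one_subproof : (1%:M : 'M[K]_2) \in symmx2.
Proof. by rewrite inE trmx1. Qed.

Fact sym2_mul_subproof (u v : J) :
  2^-1 *: (val u *m val v + val v *m val u) \in symmx2.
Proof.
have /eqP su := valP u; have /eqP sv := valP v.
by rewrite inE linearZ linearD /= !trmx_mul su sv addrC.
Qed.

Definition sym2_one : J := exist [eta mem symmx2] 1%:M sym2_one_subproof.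
Definition sym2_mul (u v : J) : J :=
  exist [eta mem symmx2] _ (sym2_mul_subproof u v).

Fact sym2_mulC : commutative sym2_mul.
Proof. by move=> u v; apply: val_inj; rewrite /= addrC. Qed.

Fact sym2_mulPl (a : K) (u v w : J) :
  sym2_mul (a *: u + v) w = a *: sym2_mul u w + sym2_mul v w.
Proof.
apply: val_inj; rewrite /= scalerA [a * _]mulrC -scalerA -scalerDr.
congr (_ *: _); rewrite mulmxDl mulmxDr -scalemxAl -scalemxAr scalerDr.
by rewrite addrACA.
Qed.

Let half_neq0 : 2 != 0 :> K.
Proof. by move: char_neq2; rewrite inE. Qed.

Let halfD (u : 'M[K]_2) : 2^-1 *: (u + u) = u.
Proof. by rewrite -mulr2n -scaler_nat scalerA mulVf // scale1r. Qed.

Fact sym2_mul1l : left_id sym2_one sym2_mul.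
Proof. by move=> u; apply: val_inj; rewrite /= mul1mx mulmx1 halfD. Qed.

Fact sym2_jordan (u v : J) :
  sym2_mul (sym2_mul (sym2_mul u u) v) u = sym2_mul (sym2_mul u u) (sym2_mul v u).
Proof.
apply: val_inj; rewrite /= halfD.
rewrite -!(scalemxAl, scalemxAr) -!scalerDr; congr (_ *: (_ *: _)).
rewrite !mulmxDl !mulmxDr !mulmxA !addrA.
by rewrite [RHS](ACl (1*3*2*4))%AC.
Qed.

HB.instance Definition _ := isJordanAlg.Build K J
  sym2_mulC sym2_mulPl sym2_mul1l sym2_jordan.

Definition sym2_scalar_grading (a : bool) : set J :=
  if a then
    lspan [set u | val u = delta_mx 0 0 - delta_mx 1 1 \/
                   val u = delta_mx 0 1 + delta_mx 1 0]
  else lspan [set u | val u = delta_mx 0 0 + delta_mx 1 1].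

Lemma sym2_scalar_grading_is_grading : is_z2grading sym2_scalar_grading.
Proof.
pose X0 : 'M[K]_2 := delta_mx 0 0 + delta_mx 1 1.
pose X1 : 'M[K]_2 := delta_mx 0 0 - delta_mx 1 1.
pose X2 : 'M[K]_2 := delta_mx 0 1 + delta_mx 1 0.
have s0 : X0 \in symmx2 by rewrite inE linearD /= !trmx_delta.
have s1 : X1 \in symmx2 by rewrite inE linearB /= !trmx_delta.
have s2 : X2 \in symmx2 by rewrite inE linearD /= !trmx_delta addrC.
have JD a u v : sym2_scalar_grading a u -> sym2_scalar_grading a v ->
    sym2_scalar_grading a (u + v).
  have [_ JP] : subspace (sym2_scalar_grading a).
    by case: a; exact: lspan_subspace.
  by move=> Ju Jv; have := JP 1 _ _ Ju Jv; rewrite scale1r.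
have JZ a c u : sym2_scalar_grading a u -> sym2_scalar_grading a (c *: u).
  have [J0 JP] : subspace (sym2_scalar_grading a).
    by case: a; exact: lspan_subspace.
  by move=> Ju; have := JP c _ _ Ju J0; rewrite addr0.
have evenP u : sym2_scalar_grading false u <-> exists c, val u = c *: X0.
  split.
    apply: (lspan_ind (W := [set u : J | exists c, val u = c *: X0])).
      split=> [|a x y [c xc] [d yd]]; first by exists 0; rewrite scale0r.
      by exists (a * c + d); rewrite /= xc yd scalerDl scalerA.
    by move=> x xE; exists 1; rewrite scale1r.
  move=> [c uc]; have -> : u = c *: (exist [eta mem symmx2] X0 s0 : J).
    exact: val_inj.
  by apply: (JZ false); exact: sub_lspan.
have oddP u : sym2_scalar_grading true u <->
    exists c d, val u = c *: X1 + d *: X2.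
  split.
    apply: (lspan_ind (W := [set u : J | exists c d, val u = c *: X1 + d *: X2])).
      split=> [|a x y [c [d xc]] [c' [d' yd]]].
        by exists 0, 0; rewrite !scale0r addr0.
      exists (a * c + c'), (a * d + d').
      by rewrite /= xc yd !scalerDl scalerDr !scalerA addrACA.
    by move=> x [|] xE; [exists 1, 0 | exists 0, 1];
      rewrite scale1r scale0r ?addr0 ?add0r.
  move=> [c [d uc]].
  have -> : u = c *: (exist [eta mem symmx2] X1 s1 : J) +
                d *: (exist [eta mem symmx2] X2 s2 : J) by exact: val_inj.
  by apply: JD; apply: (JZ true); apply: sub_lspan; [left|right].
have X0E : X0 = 1%:M.
  apply/matrixP=> i j; rewrite !mxE.
  by move: i j => [[|[|//]] ?] [[|[|//]] ?]; rewrite /= ?addr0 ?add0r.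
have X11 : X1 *m X1 = X0.
  apply/matrixP=> i j; rewrite !(mxE, big_ord_recl, big_ord0).
  by move: i j => [[|[|//]] ?] [[|[|//]] ?] /=; ring.
have X22 : X2 *m X2 = X0.
  apply/matrixP=> i j; rewrite !(mxE, big_ord_recl, big_ord0).
  by move: i j => [[|[|//]] ?] [[|[|//]] ?] /=; ring.
have X12 : X1 *m X2 + X2 *m X1 = 0.
  apply/matrixP=> i j; rewrite !(mxE, big_ord_recl, big_ord0).
  by move: i j => [[|[|//]] ?] [[|[|//]] ?] /=; ring.
split.
- by case; exact: lspan_subspace.
- move=> u; have /eqP su := valP u.
  have u10 : val u 1 0 = val u 0 1 by rewrite -[in LHS]su mxE.
  pose a := (val u 0 0 + val u 1 1) / 2; pose c := (val u 0 0 - val u 1 1) / 2.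
  exists (a *: (exist [eta mem symmx2] X0 s0 : J)).
  exists (c *: (exist [eta mem symmx2] X1 s1 : J) +
          val u 0 1 *: (exist [eta mem symmx2] X2 s2 : J)); split.
  + by apply/evenP; exists a.
  + by apply/oddP; exists c, (val u 0 1).
  + apply: val_inj => /=; apply/matrixP=> i j; rewrite !mxE /a /c.
    have o2 (k : 'I_2) : k = 0 \/ k = 1.
      by case: k => [[|[|//]] ?]; [left|right]; apply: val_inj.
    by case: (o2 i) (o2 j) => -> [] ->; rewrite ?u10 /=; field.
- move=> u /evenP[c uc] /oddP[d [e ude]]; apply: val_inj => /=.
  suff c0 : c = 0 by rewrite uc c0 scale0r.
  have /matrixP E : c *: X0 = d *: X1 + e *: X2 by rewrite -uc.
  have := E 0 0; have := E 1 1; rewrite !mxE /= => E1 E0.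
  have : 2 * c = 0.
    transitivity (c * (0 + 1) + c * (1 + 0)); first by ring.
    by rewrite E1 E0; ring.
  by move=> /eqP; rewrite mulf_eq0 (negbTE half_neq0) => /eqP.
- have X0l M : X0 *m M = M by rewrite X0E mul1mx.
  have X0r M : M *m X0 = M by rewrite X0E mulmx1.
  have X21 : X2 *m X1 + X1 *m X2 = 0 by rewrite addrC.
  by move=> [] []; apply: lspan_mul => [|u v]; try exact: lspan_subspace;
    [move=> [] ue [] ve; apply/evenP|move=> [] ue ve; apply/oddP
    |move=> ue [] ve; apply/oddP|move=> ue ve; apply/evenP];
    rewrite /= ue ve -/X0 -/X1 -/X2 ?(X0l, X0r) ?halfD;
    rewrite ?X11 ?X22 ?X12 ?X21 ?halfD ?scaler0;
    by [exists 1; rewrite scale1r | exists 0; rewrite scale0r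
       |exists 1, 0; rewrite scale1r scale0r addr0
       |exists 0, 1; rewrite scale1r scale0r add0r].
Qed.

End SymmetricMatrices.

Arguments sym2_scalar_grading {K} char_neq2 a.

Definition sym2_poly (K : fieldType) : JX K :=
  \sum_(s : 'S_3) (-1) ^+ s *:
    (zvar K (s 0) ** (zvar K 3 ** zvar K (s 1)) ** (zvar K 4 ** zvar K (s 2))).

(* Main.v *)
From HB Require Import structures.
Require Import Defs.
From mathcomp Require Import all_boot all_order all_algebra all_fingroup.
From mathcomp Require Import sesquilinear generic_quotient.
From mathcomp Require Import boolp classical_sets cardinality.
From mathcomp Require Import ring zify.

(** Modulo the polynomials [(y, x1, x2)] every even element [e] is nuclear, that
    is, [(e u) v = e (u v)] for all [u] and [v].  Hence every polynomial reduces
    to a linear combination of words: products of even variables [y_i], of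
    products [z_p z_q], and of at most one isolated odd variable.  In the algebra
    of a form [z_p z_q] is a scalar product, so the theorem amounts to the second
    fundamental theorem of invariant theory for the orthogonal group: the
    polynomial relations between the scalar products of vectors of an
    [n]-dimensional space follow from the vanishing of the minors of size [n + 1].
    Here [gpoly] is such a minor with one column replaced by odd variables, and an
    isolated [z_q] is treated as a scalar product [z_0 z_q] with an auxiliary
    vector [z_0].  This makes even and odd words objects of the same kind: some
    even variables together with a multiset of pairs [(p, q)] with [p <= q].

    The second fundamental theorem is proved with a weight, in an elementary way
    which works over every infinite field.  The weight of a multiset of pairs is
    the sum of the products [p * q].  A chain is a sequence of pairs whose two
    components both strictly increase.

    Spanning ([straightening]): a chain of length [n + 1] in a word is the main
    diagonal of a minor, and by the rearrangement inequality ([rearrangement])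
    the other terms of the minor have smaller weight.  So the words which are left
    have no such chain; equivalently ([colouring_or_chain]) their pairs can be
    coloured with [n] colours so that comparable pairs get different colours.

    Independence ([word_fun_independent]): write the vectors in an orthogonal
    family of [n] nonisotropic vectors and expand; a word becomes the sum, over
    all ways to colour its pairs with the [n] basis vectors, of monomials in the
    coordinates.  Each class of a proper colouring consists of pairwise nested
    intervals with endpoints [p] and [q], and a nested family is the unique family
    of least weight among those with the same endpoints ([nested_min]).  Hence, in
    a linear relation between properly colourable words, the monomial of a
    properly coloured word of maximal weight occurs only once and cannot cancel.
    Over an infinite field a vanishing polynomial function has zero coefficients
    ([monom_coef]), so there are no nontrivial relations.

    When the space is infinite dimensional the number of colours can be taken as
    large as the words in question, so that every word is colourable.  The
    symmetric matrices of order two contain the algebra of the dot product on the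
    plane, which is the case [n = 2]. *)

Set Implicit Arguments.
Unset Strict Implicit.
Unset Printing Implicit Defensive.

Import GRing.Theory.
Local Open Scope classical_set_scope.
Local Open Scope ring_scope.
Local Open Scope jordan_scope.

(** * Pairs of indices, chains and nested families *)

Definition pair_lt (x y : nat * nat) : bool := (x.1 < y.1)%N && (x.2 < y.2)%N.

Definition pair_wt (L : seq (nat * nat)) : nat := (\sum_(x <- L) x.1 * x.2)%N.

Definition content (L : seq (nat * nat)) : seq nat :=
  flatten [seq [:: x.1; x.2] | x <- L].

Definition colouring (n : nat) (L : seq (nat * nat)) (h : nat * nat -> nat) :=
  {in L, forall x, (h x < n)%N} /\
  {in L &, forall x y, pair_lt x y -> h x != h y}.

Lemma pair_lt_trans : transitive pair_lt.
Proof. by move=> y x z; rewrite /pair_lt => /andP[? ?] /andP[? ?]; lia. Qed.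

(** The dual of Dilworth's theorem: the minimal elements form one colour class,
    and a chain among the other elements can be extended downwards. *)
Lemma colouring_or_chain n L :
  (exists h, colouring n L h) \/
  exists c, [/\ size c = n.+1, sorted pair_lt c & {subset c <= L}].
Proof.
elim: n L => [|n IHn] L.
  case: L => [|x L]; first by left; exists (fun=> 0%N); split.
  by right; exists [:: x]; split=> // y; rewrite !inE => ->.
pose low x := ~~ has (pair_lt^~ x) L.
case: (IHn [seq x <- L | ~~ low x]) => [[h [hn hlt]]|[c [sc cs cL]]].
  left; exists (fun x => if low x then 0%N else (h x).+1); split.
    move=> x xL; case: ifPn => // nlx.
    by apply: hn; rewrite mem_filter nlx.
  move=> x y xL yL xy.
  have nly : ~~ low y by rewrite negbK; apply/hasP; exists x.
  rewrite (negbTE nly); case: ifPn => // nlx; rewrite eqSS.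
  by apply: hlt; rewrite // mem_filter ?nlx ?nly.
right; case: c sc cs cL => // x c sc cs cL.
have := cL x (mem_head _ _); rewrite mem_filter negbK => /andP[/hasP[y yL yx] _].
exists (y :: x :: c); split=> [||z]; first by rewrite /= -sc.
  by rewrite /= yx.
rewrite inE => /predU1P[->//|/cL]; by rewrite mem_filter => /andP[].
Qed.

Lemma size_colouring n L : (size L <= n)%N -> colouring n L (index^~ L).
Proof.
move=> sL; split=> [x xL|x y xL yL xy]; first by rewrite (leq_trans _ sL) ?index_mem.
apply/eqP => /(congr1 (nth (0, 0)%N L)); rewrite !nth_index // => xEy.
by move: xy; rewrite xEy /pair_lt !ltnn.
Qed.

Lemma mul_exchange_lt a b c d :
  (a < b)%N -> (c < d)%N -> (a * d + b * c < a * c + b * d)%N.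
Proof.
move=> /subnKC <- /subnKC <-; move: (b - a.+1)%N (d - c.+1)%N => e f.
by rewrite !(mulnDl, mulnDr, mulSn, mulnS); lia.
Qed.

Lemma perm_neq1_inversion n (s : 'S_n) :
  s != 1%g -> exists a b : 'I_n, (a < b)%N /\ (s b < s a)%N.
Proof.
move=> s1; have /existsP[a /existsP[b /andP[ab sba]]] :
    [exists a : 'I_n, exists b : 'I_n, (a < b)%N && (s b < s a)%N].
  apply: contraR s1 => /existsPn noinv.
  have smono (a b : 'I_n) : (a < b)%N -> (s a < s b)%N.
    move=> ab; move/existsPn/(_ b): (noinv a); rewrite ab /= -leqNgt leq_eqVlt.
    by case/orP=> // /eqP/val_inj/perm_inj abE; rewrite abE ltnn in ab.
  (* An increasing permutation satisfies i <= s i, and both sides have the same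
     sum over all i. *)
  have les (i : 'I_n) : (i <= s i)%N.
    case: i => i; elim: i => [//|i IHi] lin.
    apply: leq_ltn_trans (IHi (ltnW lin)) _.
    exact: (smono (Ordinal (ltnW lin)) (Ordinal lin) (ltnSn _)).
  have sum_eq : (\sum_(i < n) s i = \sum_(i < n) i)%N.
    by rewrite [RHS](reindex_inj (@perm_inj _ s)).
  apply/eqP/permP=> i; rewrite perm1; apply/val_inj/eqP; rewrite eq_sym.
  have /leqif_sum[_] : forall i : 'I_n, true ->
      ((i : nat) <= s i ?= iff ((i : nat) == s i))%N.
    by move=> j _; split=> //; exact: les.
  by rewrite sum_eq eqxx => /esym/forall_inP; exact.
by exists a, b.
Qed.

(** The strict rearrangement inequality: a permutation maximizing the sum has no
    inversion, since undoing one increases the sum. *)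
Lemma rearrangement n (p q : 'I_n -> nat) (s : 'S_n) :
  {homo p : a b / (a < b)%N} -> {homo q : a b / (a < b)%N} -> s != 1%g ->
  (\sum_a p a * q (s a) < \sum_a p a * q a)%N.
Proof.
move=> ltp ltq s1; pose F (t : 'S_n) := (\sum_a p a * q (t a))%N.
have inv_lt (t : 'S_n) : t != 1%g -> exists t', (F t < F t')%N.
  move=> /perm_neq1_inversion[a [b [ab tba]]]; exists (tperm a b * t)%g.
  have aNb : b != a by apply: contraTneq ab => ->; rewrite ltnn.
  rewrite /F (bigD1 a) //= (bigD1 b) //= [X in (_ < X)%N](bigD1 a) //=.
  rewrite [X in (_ < _ + X)%N](bigD1 b) //= !permM tpermL tpermR.
  rewrite [X in (_ < _ + (_ + X))%N](eq_bigr (fun i => p i * q (t i)))%N; last first.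
    by move=> i /andP[ia ib]; rewrite permM tpermD // eq_sym.
  rewrite !addnA ltn_add2r; have := ltp _ _ ab; have := ltq _ _ tba.
  move: (p a) (p b) (q (t a)) (q (t b)) => x y z w wz xy.
  exact: mul_exchange_lt.
have -> : (\sum_a p a * q a)%N = F 1%g.
  by apply: eq_bigr => a _; rewrite perm1.
rewrite -/(F s); pose m := [arg max_(t > s) F t].
have Fm t : (F t <= F m)%N by rewrite /m; case: arg_maxnP => // i _; apply.
have mE : m = 1%g.
  by apply/eqP; apply: contraT => /inv_lt[t']; rewrite ltnNge Fm.
rewrite -mE; have [t' lt'] := inv_lt s s1; exact: leq_trans lt' (Fm t').
Qed.

Notation cpair := ((nat * nat) * nat)%type.

Definition ccontent (c : seq cpair) : seq (nat * nat) :=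
  flatten [seq [:: (x.1.1, x.2); (x.1.2, x.2)] | x <- c].

(** A pair [(p, q)] with [p <= q] is read as an interval; of two intervals which
    are incomparable for [pair_lt], one contains the other. *)
Definition nested (m : seq cpair) :=
  {in m &, forall x y : cpair, x.2 = y.2 -> ~~ pair_lt x.1 y.1}.

Lemma ccontentP v c :
  reflect (exists x, x \in c /\ (v = (x.1.1, x.2) \/ v = (x.1.2, x.2)))
          (v \in ccontent c).
Proof.
apply: (iffP flattenP) => [[s /mapP[x xc ->]]|[x [xc vx]]].
  by rewrite !inE => /orP[]/eqP ->; exists x; split; auto.
exists [:: (x.1.1, x.2); (x.1.2, x.2)]; first by apply/mapP; exists x.
by rewrite !inE; case: vx => ->; rewrite eqxx ?orbT.
Qed.

Lemma perm_ccontent c c' : perm_eq c c' -> perm_eq (ccontent c) (ccontent c').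
Proof. by move=> cc'; exact: perm_flatten (perm_map _ cc'). Qed.

Lemma perm_pair_wt L L' : perm_eq L L' -> pair_wt L = pair_wt L'.
Proof. by move=> LL'; exact: (perm_big _ LL'). Qed.

Lemma pair_wt_cons x L : pair_wt (x :: L) = (x.1 * x.2 + pair_wt L)%N.
Proof. exact: big_cons. Qed.

(** The relation [p <= p' && q' <= q] between pairs [(p, q)] and [(p', q')] is a
    total preorder on the pairs of one colour, so there is a largest pair. *)
Lemma nested_outermost (m : seq cpair) (k : nat) :
  nested m -> has (fun x : cpair => x.2 == k) m ->
  exists2 x : cpair, x \in m & x.2 = k /\
    {in m, forall y : cpair, y.2 = k -> (x.1.1 <= y.1.1)%N && (y.1.2 <= x.1.2)%N}.
Proof.
elim: m => [//|x m IHm] nm.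
have nm' : nested m by move=> y z ym zm; apply: nm; rewrite inE ?ym ?zm orbT.
have [/(IHm nm')[y ym [yk youter]] _|nohas /=] := boolP (has (fun x : cpair => x.2 == k) m).
  have [xk|xk] := eqVneq x.2 k; last first.
    exists y; rewrite ?inE ?ym ?orbT //; split=> // z.
    rewrite inE => /predU1P[->|zm]; last exact: youter.
    by move=> xk'; rewrite xk' eqxx in xk.
  have xm : x \in x :: m by rewrite mem_head.
  have ym' : y \in x :: m by rewrite inE ym orbT.
  have := nm x y xm ym'; rewrite xk yk => /(_ erefl).
  have := nm y x ym' xm; rewrite xk yk => /(_ erefl).
  rewrite /pair_lt => nyx nxy.
  have [xy|yx] : (x.1.1 <= y.1.1)%N && (y.1.2 <= x.1.2)%N \/
      (y.1.1 <= x.1.1)%N && (x.1.2 <= y.1.2)%N by lia.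
    exists x => //; split=> // z; rewrite inE => /predU1P[-> _|zm zk]; first lia.
    by have := youter z zm zk; lia.
  exists y => //; split=> // z; rewrite inE => /predU1P[-> _|zm zk]; first lia.
  exact: youter.
rewrite (negbTE nohas) orbF => /eqP xk; exists x; first exact: mem_head.
split=> // y; rewrite inE => /predU1P[-> _|ym yk]; first lia.
by case/hasP: nohas; exists y; rewrite // yk.
Qed.

(** Exchanging endpoints so as to create the outermost interval [(p0, q0)] of a
    colour from [(p0, q)] and [(p, q0)] preserves the content and lowers the
    weight, because
    [p0 * q + p * q0 - (p0 * q0 + p * q) = (p - p0) * (q0 - q)].  Once the outermost
    interval is common to both families it can be removed. *)
Lemma nested_min (m c : seq cpair) :
  {in m, forall x : cpair, x.1.1 <= x.1.2}%N -> {in c, forall x : cpair, x.1.1 <= x.1.2}%N ->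
  nested m -> perm_eq (ccontent c) (ccontent m) ->
  (pair_wt (unzip1 m) <= pair_wt (unzip1 c))%N /\
  (pair_wt (unzip1 c) = pair_wt (unzip1 m) -> perm_eq c m).
Proof.
have [N] := ubnP (size m); elim: N m c => [//|N IHN] m c sm om oc nm pcm.
case: m sm om nm pcm => [|x1 m1] sm om nm pcm.
  case: c oc pcm => [|x c] oc pcm; first by split.
  by have := perm_size pcm.
have [x0 x0m [x0k x0out]] : exists2 x : cpair, x \in x1 :: m1 & x.2 = x1.2 /\
    {in x1 :: m1, forall y : cpair, y.2 = x1.2 ->
       (x.1.1 <= y.1.1)%N && (y.1.2 <= x.1.2)%N}.
  by apply: nested_outermost => //=; rewrite eqxx.
set m := x1 :: m1 in sm om nm pcm x0m x0out; rewrite -x0k in x0out.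
case: x0 x0m x0out {x0k} => -[p0 q0] k /= x0m x0out.
pose m' := rem ((p0, q0), k) m; have pm : perm_eq m (((p0, q0), k) :: m').
  exact: perm_to_rem.
have m'sub : {subset m' <= m} by move=> y /mem_rem.
have sm' : (size m' < N)%N.
  by move: sm; rewrite (perm_size pm).
have om' : {in m', forall x : cpair, x.1.1 <= x.1.2}%N by move=> y /m'sub /om.
have nm' : nested m' by move=> y z /m'sub ym /m'sub zm; exact: nm.
have wm : pair_wt (unzip1 m) = (p0 * q0 + pair_wt (unzip1 m'))%N.
  by rewrite (perm_pair_wt (perm_map _ pm)) /= pair_wt_cons.
have bnd v : (v, k) \in ccontent c -> (p0 <= v <= q0)%N.
  rewrite (perm_mem pcm) => /ccontentP[y [ym]] vy.
  have yk : y.2 = k by case: vy => -[].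
  have := x0out y ym yk; have := om y ym.
  by case: vy => -[-> _]; lia.
have p0q0 := om _ x0m; rewrite /= in p0q0.
have incl (x : cpair) : x \in c -> x.2 = k -> (p0 <= x.1.1)%N && (x.1.2 <= q0)%N.
  move=> xc xk.
  have /bnd : (x.1.1, k) \in ccontent c.
    by apply/ccontentP; exists x; rewrite xk; auto.
  have /bnd : (x.1.2, k) \in ccontent c.
    by apply/ccontentP; exists x; rewrite xk; auto.
  by move=> /andP[_ ->] /andP[-> _].
have [x [xc xk xp]] : exists x : cpair, [/\ x \in c, x.2 = k & x.1.1 = p0].
  have /ccontentP[x [xc]] : (p0, k) \in ccontent c.
    by rewrite (perm_mem pcm); apply/ccontentP; exists ((p0, q0), k); auto.
  move=> xv; have xk : x.2 = k by case: xv => -[].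
  exists x; split=> //; have := incl x xc xk; have := oc x xc.
  by case: xv => -[-> _]; lia.
have [y [yc yk yq]] : exists y : cpair, [/\ y \in c, y.2 = k & y.1.2 = q0].
  have /ccontentP[y [yc]] : (q0, k) \in ccontent c.
    by rewrite (perm_mem pcm); apply/ccontentP; exists ((p0, q0), k); auto.
  move=> yv; have yk : y.2 = k by case: yv => -[].
  exists y; split=> //; have := incl y yc yk; have := oc y yc.
  by case: yv => -[-> _]; lia.
have shared : ((p0, q0), k) \in c ->
    (pair_wt (unzip1 m) <= pair_wt (unzip1 c))%N /\
    (pair_wt (unzip1 c) = pair_wt (unzip1 m) -> perm_eq c m).
  move=> x0c; pose c' := rem ((p0, q0), k) c.
  have pc : perm_eq c (((p0, q0), k) :: c') by exact: perm_to_rem.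
  have oc' : {in c', forall x : cpair, x.1.1 <= x.1.2}%N by move=> z /mem_rem /oc.
  have pcm' : perm_eq (ccontent c') (ccontent m').
    have := perm_ccontent pc; rewrite perm_sym => /perm_trans/(_ pcm).
    by move=> /perm_trans/(_ (perm_ccontent pm)) /=; rewrite !perm_cons.
  have [le eq] := IHN m' c' sm' om' oc' nm' pcm'.
  have wc : pair_wt (unzip1 c) = (p0 * q0 + pair_wt (unzip1 c'))%N.
    by rewrite (perm_pair_wt (perm_map _ pc)) /= pair_wt_cons.
  rewrite wm wc leq_add2l; split=> // /addnI /eq c'm'.
  apply: perm_trans pc _; rewrite perm_sym; apply: perm_trans pm _.
  by rewrite perm_cons perm_sym.
case: x xc xk xp => -[p' q] k' /= xc xk xp; subst p' k'.
case: y yc yk yq => -[p q'] k' /= yc yk yq; subst q' k'.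
have [qE|qN] := eqVneq q q0; first by apply: shared; rewrite -qE.
have [pE|pN] := eqVneq p p0; first by apply: shared; rewrite -pE.
have := incl _ xc erefl; have := incl _ yc erefl; rewrite /= => pb qb.
pose c' := rem ((p, q0), k) (rem ((p0, q), k) c).
have pc : perm_eq c [:: ((p0, q), k), ((p, q0), k) & c'].
  apply: (perm_trans (perm_to_rem xc)); rewrite perm_cons; apply: perm_to_rem.
  have := yc; rewrite (perm_mem (perm_to_rem xc)) inE => /predU1P[[pE _]|//].
  by rewrite pE eqxx in pN.
pose z := ((minn p q, maxn p q), k).
have oc' : {in z :: c', forall x : cpair, x.1.1 <= x.1.2}%N.
  move=> w; rewrite inE => /predU1P[->|/mem_rem/mem_rem/oc//].
  by rewrite /z /=; case: (leqP p q) => // /ltnW.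
have pcm' : perm_eq (ccontent (z :: c')) (ccontent m').
  rewrite -(perm_cat2l [:: (p0, k); (q0, k)]).
  rewrite -/(ccontent (((p0, q0), k) :: m')).
  rewrite -(permPr (perm_ccontent pm)) -(permPr pcm) (permPr (perm_ccontent pc)).
  rewrite /z /ccontent /=; apply/seq.permP=> P /=.
  case: (leqP p q) => _ /=;
  move: (count P _) (P (p0, k)) (P (q0, k)) (P (p, k)) (P (q, k)); clear; lia.
have [le _] := IHN m' (z :: c') sm' om' oc' nm' pcm'.
have wz : (minn p q * maxn p q = p * q)%N by case: (leqP p q) => _ //; rewrite mulnC.
have wc : pair_wt (unzip1 c) = (p0 * q + p * q0 + pair_wt (unzip1 c'))%N.
  by rewrite (perm_pair_wt (perm_map _ pc)) /= !pair_wt_cons addnA.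
have lt : (p0 * q0 + p * q < p0 * q + p * q0)%N.
  case/andP: pb => pb _; case/andP: qb => _ qb.
  by apply: mul_exchange_lt; rewrite ltn_neqAle ?qN // eq_sym pN.
have ltw : (pair_wt (unzip1 m) < pair_wt (unzip1 c))%N.
  rewrite wm wc; apply: leq_ltn_trans (_ : p0 * q0 + (p * q + pair_wt (unzip1 c')) < _)%N.
    by rewrite leq_add2l -wz -(pair_wt_cons z.1); exact: le.
  by rewrite addnA ltn_add2r.
by split; [exact: ltnW | move=> E; move: ltw; rewrite E ltnn].
Qed.

(** * Monomial functions over an infinite field *)

Section Monomials.
Variables (K : fieldType) (Kinf : infinite_set [set: K]).

Lemma infinite_uniq_seq m : exists s : seq K, uniq s /\ size s = m.
Proof.
elim: m => [|m [s [us sm]]]; first by exists [::].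
have [t ts] : exists t, t \notin s.
  apply: contrapT => nex; apply: Kinf.
  apply: (sub_finite_set (B := [set` s])); last exact: finite_seq.
  by move=> t _ /=; apply: contrapT => /negP tNs; apply: nex; exists t.
by exists (t :: s); rewrite /= ts us sm.
Qed.

Lemma exprn_separate (i j : nat) : i != j -> exists t : K, t ^+ i != t ^+ j.
Proof.
move=> ij; apply: contrapT => nex.
have [s [us ss]] := infinite_uniq_seq (i + j).+1.
have pN0 : ('X^i - 'X^j : {poly K}) != 0.
  by apply: contra ij => /eqP/polyP/(_ i); rewrite coefB !coefXn coef0 eqxx;
    case: eqVneq => // _ /eqP; rewrite subr0 oner_eq0.
have roots : all (root ('X^i - 'X^j : {poly K})) s.
  apply/allP=> t _; rewrite rootE !hornerE subr_eq0.
  by apply: contrapT => /negP tij; apply: nex; exists t.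
have := max_poly_roots pN0 roots us; rewrite ss ltnNge => /negP[].
apply: leq_trans (size_polyD _ _) _.
by rewrite size_polyN !size_polyXn; lia.
Qed.

Variable T : eqType.
Implicit Types (l : seq T) (x : T -> K).

Definition monom x l : K := \prod_(v <- l) x v.

Lemma monom_cat x l l' : monom x (l ++ l') = monom x l * monom x l'.
Proof. exact: big_cat. Qed.

Lemma monom_mul x x' l : monom (fun v => x v * x' v) l = monom x l * monom x' l.
Proof. exact: big_split. Qed.

Lemma monom_separate l l' :
  ~~ perm_eq l l' -> exists x, monom x l != monom x l'.
Proof.
rewrite /perm_eq => /allPn[v _ /exprn_separate[t tlr]].
exists (fun u => if u == v then t else 1).
suff E s : monom (fun u => if u == v then t else 1) s = t ^+ count_mem v s.
  by rewrite !E.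
by rewrite /monom -big_mkcond big_const_seq iter_mulr_1.
Qed.

(** Coefficient extraction, by the argument of Artin's theorem on the
    independence of characters: monomial functions are multiplicative in [x], so
    a relation can be shortened by combining it with its translate at a point
    which separates two of its monomials. *)
Lemma monom_coef (r : seq (K * seq T)) l :
  (forall x, \sum_(m <- r) m.1 * monom x m.2 = 0) ->
  \sum_(m <- r | perm_eq m.2 l) m.1 = 0.
Proof.
have [N] := ubnP (size r); elim: N r => [//|N IHN] r sr r0.
have [/allP all_l|/allPn[m0 m0r m0l]] := boolP (all (fun m => perm_eq m.2 l) r).
  rewrite -[RHS](r0 (fun=> 1)) big_seq_cond [RHS]big_seq_cond.
  apply: eq_big => [m|m _]; last by rewrite /monom big1 ?mulr1.
  by rewrite andbT; case: (boolP (m \in r)) => // /all_l.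
have [x0 x0sep] := monom_separate m0l.
pose r' := [seq (m.1 * (monom x0 m.2 - monom x0 m0.2), m.2) | m <- rem m0 r].
have sr' : (size r' < N)%N by rewrite size_map size_rem //; case: (r) m0r sr.
have /(IHN r' sr') : forall x, \sum_(m <- r') m.1 * monom x m.2 = 0.
  move=> x; rewrite big_map /=.
  have E : \sum_(m <- r) m.1 * (monom x0 m.2 - monom x0 m0.2) * monom x m.2 = 0.
    transitivity (\sum_(m <- r) (m.1 * monom (fun v => x0 v * x v) m.2 -
                                 monom x0 m0.2 * (m.1 * monom x m.2))).
      by apply: eq_bigr => m _; rewrite monom_mul; ring.
    by rewrite sumrB -mulr_sumr !r0 mulr0 subr0.
  by move: E; rewrite (perm_big _ (perm_to_rem m0r)) /= big_cons subrr mulr0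
                      mul0r add0r.
rewrite big_map /=.
rewrite (eq_bigr (fun m => m.1 * (monom x0 l - monom x0 m0.2))); last first.
  by move=> m /(perm_big _) ml; rewrite /monom ml.
rewrite -mulr_suml => /eqP; rewrite mulf_eq0 subr_eq0.
rewrite [_ == monom x0 m0.2]eq_sym (negbTE x0sep) orbF.
by rewrite (perm_big _ (perm_to_rem m0r)) /= big_cons (negbTE m0l) => /eqP.
Qed.

End Monomials.

Fixpoint colourings (n : nat) (L : seq (nat * nat)) : seq (seq cpair) :=
  if L is x :: L' then [seq (x, k) :: c | k <- iota 0 n, c <- colourings n L']
  else [:: [::]].

Lemma prod_sum_colourings (R : comPzRingType) n L (F : nat * nat -> nat -> R) :
  \prod_(x <- L) \sum_(k <- iota 0 n) F x k =
  \sum_(c <- colourings n L) \prod_(y <- c) F y.1 y.2.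
Proof.
elim: L => [|x L IHL] /=; first by rewrite big_seq1 !big_nil.
rewrite big_cons IHL big_allpairs_dep mulr_suml; apply: eq_bigr => k _.
by rewrite mulr_sumr; apply: eq_bigr => c _; rewrite big_cons.
Qed.

Lemma mem_colourings n L c :
  (c \in colourings n L) = (unzip1 c == L) && all (fun y => y.2 < n)%N c.
Proof.
elim: L c => [|x L IHL] c /=; first by case: c.
apply/allpairsP/idP => [[[k c'] /= [kn]]|].
  by move: kn; rewrite mem_iota IHL /= => kn /andP[/eqP<- cn] -> /=; rewrite eqxx kn.
case: c => [//|[y k] c] /= /andP[/eqP[-> cL] /andP[kn cn]].
by exists (k, c); rewrite mem_iota kn IHL cL eqxx cn.
Qed.

Lemma colourings_uniq n L : uniq (colourings n L).
Proof.
elim: L => [//|x L IHL] /=; apply: allpairs_uniq => //; first exact: iota_uniq.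
by move=> [k c] [k' c'] _ _ /= [-> ->].
Qed.

(** * Products of nuclear elements in a Jordan algebra *)

Section JordanProducts.
Variables (K : fieldType) (A : jordanAlgType K).
Implicit Types u v w e : A.

Lemma jmulDl u v w : (u + v) ** w = u ** w + v ** w.
Proof. by have := jmulPl 1 u v w; rewrite !scale1r. Qed.

Lemma jmulDr u v w : w ** (u + v) = w ** u + w ** v.
Proof. by rewrite ![w ** _]jmulC jmulDl. Qed.

Lemma jmul0l w : 0 ** w = 0.
Proof. by have := jmulPl (-1) 0 0 w; rewrite scaler0 addr0 scaleN1r addNr. Qed.

Lemma jmulZl a u w : (a *: u) ** w = a *: (u ** w).
Proof. by have := jmulPl a u 0 w; rewrite jmul0l !addr0. Qed.

Lemma jmul1r w : w ** jone = w.
Proof. by rewrite jmulC jmul1l. Qed.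

Lemma jmul_suml I (r : seq I) (P : pred I) (F : I -> A) w :
  (\sum_(i <- r | P i) F i) ** w = \sum_(i <- r | P i) F i ** w.
Proof.
by apply: (big_morph (jmul^~ w)) => [u v|]; [exact: jmulDl | exact: jmul0l].
Qed.

Definition nuclear e := forall u v, (e ** u) ** v = e ** (u ** v).

Lemma nuclear1 : nuclear jone.
Proof. by move=> u v; rewrite !jmul1l. Qed.

Lemma nuclearM e e' : nuclear e -> nuclear e' -> nuclear (e ** e').
Proof. by move=> ne ne' u v; rewrite !ne ne'. Qed.

Lemma nuclearCA e u v : nuclear e -> u ** (e ** v) = e ** (u ** v).
Proof. by move=> ne; rewrite jmulC ne [v ** u]jmulC. Qed.

Lemma nuclearAr e u v : nuclear e -> u ** (v ** e) = (u ** v) ** e.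
Proof. by move=> ne; rewrite ![_ ** e]jmulC nuclearCA. Qed.

Definition jprod (s : seq A) : A := foldr (@jmul K A) jone s.

Lemma foldl_jmul T (f : T -> A) s u : (forall x, nuclear (f x)) ->
  foldl (fun w x => w ** f x) u s = u ** jprod (map f s).
Proof.
move=> nf; elim: s u => [|x s IHs] u /=; first by rewrite jmul1r.
by rewrite IHs nuclearCA // [u ** _]jmulC nf.
Qed.

Section NuclearFactors.
Variables (T : eqType) (f : T -> A) (bad : pred T).
Hypothesis nf : forall x, ~~ bad x -> nuclear (f x).

Lemma jprod_nuclear s : count bad s = 0%N -> nuclear (jprod (map f s)).
Proof.
elim: s => [_|x s IHs] /=; first exact: nuclear1.
case: (boolP (bad x)) => // bx; rewrite add0n => /IHs.
by apply: nuclearM; exact: nf.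
Qed.

Lemma jprod_cat s t : (count bad s + count bad t <= 1)%N ->
  jprod (map f (s ++ t)) = jprod (map f s) ** jprod (map f t).
Proof.
elim: s => [_|x s IHs] /=; first by rewrite jmul1l.
case: (boolP (bad x)) => bx st; rewrite IHs; try lia; last by rewrite nf.
by rewrite nuclearAr //; apply: jprod_nuclear; lia.
Qed.

(** One factor may be arbitrary: the nuclear ones can be moved across it.  This
    is the case of the isolated variable of an odd word. *)
Lemma jprod_perm s t : (count bad s <= 1)%N -> perm_eq s t ->
  jprod (map f s) = jprod (map f t).
Proof.
have front x r : x \in r -> (count bad r <= 1)%N ->
    jprod (map f r) = f x ** jprod (map f (rem x r)).
  elim: r => [//|y r IHr] /=; have [-> //|yx] := eqVneq y x.
  rewrite inE eq_sym (negbTE yx) /= => xr br.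
  rewrite (IHr xr); last by move: br; lia.
  move: br; rewrite (seq.permP (perm_to_rem xr)) /=.
  case: (boolP (bad y)) => [_|/nf ny _]; last by rewrite [RHS]nuclearCA.
  by case: (boolP (bad x)) => [|/nf nx]; [lia | rewrite nuclearCA].
elim: s t => [|x s IHs] t bs st.
  by move/perm_size: st => /esym/size0nil ->.
have xt : x \in t by rewrite -(perm_mem st) mem_head.
rewrite (front x t xt) -?(seq.permP st) //=; congr (_ ** _); apply: IHs.
  by move: bs => /=; lia.
by rewrite -(perm_cons x) (permPl st); exact: perm_to_rem.
Qed.

End NuclearFactors.
End JordanProducts.

(** * Linear spans *)

Section LinearSpans.
Variables (K : fieldType) (V : lmodType K).

Lemma subspaceD (W : set V) u v : subspace W -> W u -> W v -> W (u + v).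
Proof. by move=> [_ WP] Wu Wv; rewrite -[u]scale1r; exact: WP. Qed.

Lemma subspaceZ (W : set V) a u : subspace W -> W u -> W (a *: u).
Proof. by move=> [W0 WP] Wu; rewrite -[_ *: _]addr0; exact: WP. Qed.

Lemma subspace_sum (W : set V) I (r : seq I) (P : pred I) (F : I -> V) :
  subspace W -> (forall i, P i -> W (F i)) -> W (\sum_(i <- r | P i) F i).
Proof.
move=> sW WF; apply: big_ind => //; first exact: sW.1.
by move=> u v; exact: subspaceD.
Qed.

Lemma lspan_uniq_sum (T : choiceType) (P : set T) (f : T -> V) u :
  lspan [set f t | t in P] u ->
  exists s (c : T -> K), [/\ uniq s, {in s, forall t, P t} &
    u = \sum_(t <- s) c t *: f t].
Proof.
pose W := [set u | exists s (c : T -> K), [/\ uniq s, {in s, forall t, P t} &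
  u = \sum_(t <- s) c t *: f t]].
move: u; apply: (lspan_ind (W := W)); last first.
  move=> _ [t Pt <-]; exists [:: t], (fun=> 1); rewrite big_seq1 scale1r.
  by split=> // t'; rewrite inE => /eqP ->.
split=> [|a u v [s [c [us Ps ->]]] [s' [c' [us' Ps' ->]]]].
  by exists [::], (fun=> 0); split; rewrite // big_nil.
pose in_s (s'' : seq T) (c'' : T -> K) t := if t \in s'' then c'' t else 0.
exists (undup (s ++ s')), (fun t => a * in_s s c t + in_s s' c' t).
split; first exact: undup_uniq.
  by move=> t; rewrite mem_undup mem_cat => /orP[/Ps|/Ps'].
have E s1 c1 : uniq s1 -> {subset s1 <= s ++ s'} ->
    \sum_(t <- s1) c1 t *: f t = \sum_(t <- undup (s ++ s')) in_s s1 c1 t *: f t.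
  move=> us1 s1s; rewrite [RHS](eq_bigr (fun t => if t \in s1 then c1 t *: f t else 0)).
    rewrite -big_mkcond -[RHS]big_filter; apply: perm_big; apply: uniq_perm => //.
      by rewrite filter_uniq ?undup_uniq.
    move=> t; rewrite mem_filter mem_undup andbC.
    by case: (boolP (t \in s1)) => [/s1s ->|]; rewrite ?andbF.
  by move=> t _; rewrite /in_s; case: ifP; rewrite ?scale0r.
rewrite (E s) // ?(E s') //; last first.
- by move=> t ts; rewrite mem_cat ts.
- by move=> t ts; rewrite mem_cat ts orbT.
rewrite scaler_sumr -big_split; apply: eq_bigr => t _ /=.
by rewrite scalerDl scalerA.
Qed.

End LinearSpans.

(** * Words and their values *)

Notation word := (seq nat * seq (nat * nat))%type.

(** The index 0 stands for an absent odd variable, and the index [p.+1] for the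
    odd variable number [p].  A pair with one index 0 is thus an isolated odd
    variable, and a word with at most one zero is even or odd according to the
    number of its zeros. *)
Definition zeros (L : seq (nat * nat)) : nat :=
  (\sum_(x <- L) ((x.1 == 0) + (x.2 == 0)))%N.

Lemma zeros_cat L L' : zeros (L ++ L') = (zeros L + zeros L')%N.
Proof. exact: big_cat. Qed.

Lemma zeros_cons x L : zeros (x :: L) = ((x.1 == 0) + (x.2 == 0) + zeros L)%N.
Proof. exact: big_cons. Qed.

Lemma pair_wt_cat L L' : pair_wt (L ++ L') = (pair_wt L + pair_wt L')%N.
Proof. exact: big_cat. Qed.

Lemma perm_zeros L L' : perm_eq L L' -> zeros L = zeros L'.
Proof. by move=> LL'; exact: (perm_big _ LL'). Qed.

Definition pair_le (x y : nat * nat) : bool :=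
  (x.1 < y.1)%N || (x.1 == y.1) && (x.2 <= y.2)%N.

Lemma pair_le_total : total pair_le.
Proof. by move=> [x x'] [y y']; rewrite /pair_le /=; lia. Qed.

Lemma pair_le_trans : transitive pair_le.
Proof. by move=> [y y'] [x x'] [z z']; rewrite /pair_le /=; lia. Qed.

Lemma pair_le_anti : antisymmetric pair_le.
Proof.
move=> [x x'] [y y']; rewrite /pair_le /= => xy.
have -> : x = y by lia.
by have -> : x' = y' by lia.
Qed.

Definition order_pair (x : nat * nat) := (minn x.1 x.2, maxn x.1 x.2).

Definition normal (w : word) : bool :=
  [&& sorted leq w.1, sorted pair_le w.2, all (fun x => x.1 <= x.2)%N w.2 &
      (zeros w.2 <= 1)%N].

Definition normal_form (w : word) : word :=
  (sort leq w.1, sort pair_le (map order_pair w.2)).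

Lemma zeros_order L : zeros (map order_pair L) = zeros L.
Proof.
rewrite /zeros big_map; apply: eq_bigr => -[p q] _ /=.
by case: (leqP p q) => _ //; rewrite addnC.
Qed.

Lemma pair_wt_order L : pair_wt (map order_pair L) = pair_wt L.
Proof.
rewrite /pair_wt big_map; apply: eq_bigr => -[p q] _ /=.
by case: (leqP p q) => _ //; rewrite mulnC.
Qed.

Lemma perm_normal_form w : perm_eq (normal_form w).2 (map order_pair w.2).
Proof. by rewrite perm_sort. Qed.

Lemma normal_form_normal w : (zeros w.2 <= 1)%N -> normal (normal_form w).
Proof.
move=> w0; rewrite /normal (perm_zeros (perm_normal_form w)) zeros_order w0 /=.
rewrite (sort_sorted leq_total) (sort_sorted pair_le_total) /= andbT.
rewrite all_sort all_map; apply/allP=> x _ /=.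
by case: (leqP x.1 x.2) => // /ltnW.
Qed.

Lemma normal_perm_eq w w' : normal w -> normal w' ->
  perm_eq w.1 w'.1 -> perm_eq w.2 w'.2 -> w = w'.
Proof.
case: w w' => [ys L] [ys' L'] /and4P[/= sy sL _ _] /and4P[/= sy' sL' _ _] yy LL.
congr pair; first exact: (sorted_eq leq_trans anti_leq).
exact: (sorted_eq pair_le_trans pair_le_anti).
Qed.

Lemma zeros1_split L : all (fun x => x.1 <= x.2)%N L -> zeros L = 1%N ->
  exists q R, perm_eq L ((0, q.+1)%N :: R) /\ zeros R = 0%N.
Proof.
move=> oL zL; have : has (fun x => (x.1 == 0) || (x.2 == 0))%N L.
  apply: contraPT zL => /hasPn noz; rewrite /zeros big_seq big1 // => x xL.
  by have := noz x xL; case: (x.1) (x.2) => [|?] [|?].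
case/hasP=> -[p q] xL /= pq0; have /= pq := allP oL _ xL.
have p0 : p = 0%N by lia.
subst p; have LE := perm_to_rem xL; move: zL; rewrite (perm_zeros LE) zeros_cons /=.
case: q {pq0 pq} xL LE => [|q] xL LE; first by lia.
by move=> [zR]; exists q, (rem (0, q.+1)%N L).
Qed.

Section WordValues.
Variables (K : fieldType) (A : jordanAlgType K) (yv zv : nat -> A).

Definition zval (p : nat) : A := if p is p'.+1 then zv p' else jone.
Definition pair_val (x : nat * nat) : A := zval x.1 ** zval x.2.
Definition factor_val (t : nat + nat * nat) : A :=
  match t with inl i => yv i | inr x => pair_val x end.
Definition factors (w : word) := map inr w.2 ++ map inl w.1.
Definition word_val (w : word) : A := jprod (map factor_val (factors w)).

Lemma pair_val_order x : pair_val (order_pair x) = pair_val x.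
Proof. by rewrite /pair_val /=; case: (leqP x.1 x.2) => // _; exact: jmulC. Qed.

Hypotheses (nuc_y : forall i, nuclear (yv i))
           (nuc_zz : forall i j, nuclear (zv i ** zv j)).

Let odd_factor (t : nat + nat * nat) : bool :=
  if t is inr x then (x.1 == 0%N) || (x.2 == 0%N) else false.

Let factor_nuclear t : ~~ odd_factor t -> nuclear (factor_val t).
Proof. by case: t => //= -[[|p] [|q]] //= _; exact: nuc_zz. Qed.

Let odd_factors_zeros w : (count odd_factor (factors w) <= zeros w.2)%N.
Proof.
rewrite /factors count_cat !count_map.
rewrite [X in (_ + X)%N](_ : _ = 0%N) ?addn0; last first.
  by rewrite (eq_count (a2 := pred0)) ?count_pred0.
elim: (w.2) => [|x L IHL] //=; rewrite zeros_cons leq_add //.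
by case: (x.1) (x.2) => [|?] [|?].
Qed.

Lemma word_val_perm ys ys' L L' : (zeros L <= 1)%N ->
  perm_eq ys ys' -> perm_eq L L' -> word_val (ys, L) = word_val (ys', L').
Proof.
move=> zL py pL; apply: (jprod_perm factor_nuclear).
  by apply: leq_trans zL; exact: (odd_factors_zeros (ys, L)).
by apply: perm_cat; exact: perm_map.
Qed.

Lemma word_val_cat ys ys' L L' : (zeros L + zeros L' <= 1)%N ->
  word_val (ys, L) ** word_val (ys', L') = word_val (ys ++ ys', L ++ L').
Proof.
move=> zL; rewrite -(jprod_cat factor_nuclear); last first.
  by apply: leq_trans zL; apply: leq_add; exact: odd_factors_zeros.
apply: (jprod_perm factor_nuclear); last first.
  by rewrite /factors /= !map_cat -!catA perm_cat2l perm_catCA.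
by rewrite count_cat; apply: leq_trans zL; apply: leq_add; exact: odd_factors_zeros.
Qed.

Lemma word_val_nuclear ys L : zeros L = 0%N -> nuclear (word_val (ys, L)).
Proof.
move=> zL; apply: (jprod_nuclear factor_nuclear); apply/eqP.
by rewrite -leqn0 -zL; exact: odd_factors_zeros.
Qed.

Lemma word_val_cons x ys L : word_val (ys, x :: L) = pair_val x ** word_val (ys, L).
Proof. by []. Qed.

Lemma word_val_normal_form w : (zeros w.2 <= 1)%N ->
  word_val (normal_form w) = word_val w.
Proof.
case: w => ys L /= zL.
rewrite (word_val_perm (ys' := ys) (L' := map order_pair L)) ?perm_sort //; last first.
  by rewrite (perm_zeros (L' := map order_pair L)) ?zeros_order ?perm_sort.
rewrite /word_val /factors /= !map_cat -!map_comp; congr (jprod (_ ++ _)).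
by apply: eq_map => x /=; exact: pair_val_order.
Qed.

Definition normal_span : set A := lspan [set word_val w | w in [set w | normal w]].

Lemma normal_span_word w : (zeros w.2 <= 1)%N -> normal_span (word_val w).
Proof.
move=> zw; rewrite -word_val_normal_form //; apply: sub_lspan.
by exists (normal_form w) => //=; exact: normal_form_normal.
Qed.

(** The product of two odd words is an even word: the two missing indices are
    filled by each other. *)
Lemma normal_spanM u v : normal_span u -> normal_span v -> normal_span (u ** v).
Proof.
apply: lspan_mul; first exact: lspan_subspace.
move=> _ _ [[ys L] /and4P[/= _ _ oL zL] <-] [[ys' L'] /and4P[/= _ _ oL' zL'] <-].
have [zLL'|zLL'] := leqP (zeros L + zeros L') 1%N.
  by rewrite word_val_cat //; apply: normal_span_word; rewrite /= zeros_cat.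
have [z1 z1'] : zeros L = 1%N /\ zeros L' = 1%N by lia.
have [q [R [LE zR]]] := zeros1_split oL z1.
have [q' [R' [LE' zR']]] := zeros1_split oL' z1'.
have E : word_val (ys, L) ** word_val (ys', L') =
         word_val (ys ++ ys', (q.+1, q'.+1) :: R ++ R').
  rewrite (word_val_perm _ (perm_refl _) LE) ?(word_val_perm _ (perm_refl _) LE') //.
  rewrite !word_val_cons -(word_val_cat ys ys') ?zR ?zR' // /pair_val /= !jmul1l.
  have nR := word_val_nuclear ys zR; have nR' := word_val_nuclear ys' zR'.
  by rewrite ![zv _ ** word_val _]jmulC nR (nuclearCA _ _ nR') [RHS]jmulC nR.
rewrite E; apply: normal_span_word.
by rewrite /= zeros_cons zeros_cat zR zR'.
Qed.

Lemma normal_span_eval t :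
  normal_span (jterm_eval (fun x : gvar => if x.1 then zv x.2 else yv x.2) t).
Proof.
have sN : subspace normal_span by exact: lspan_subspace.
elim: t => [[a i]|||s IHs t IHt|a s IHs|s IHs t IHt] /=.
- case: a => /=; last first.
    suff -> : yv i = word_val ([:: i], [::]).
      by apply: normal_span_word; rewrite /zeros /= big_nil.
    by rewrite /word_val /= jmul1r.
  suff -> : zv i = word_val ([::], [:: (0, i.+1)%N]).
    by apply: normal_span_word; rewrite /zeros /= big_seq1.
  by rewrite /word_val /= /pair_val /= jmul1l jmul1r.
- exact: sN.1.
- suff -> : jone = word_val ([::], [::]) by apply: normal_span_word; rewrite /zeros big_nil.
  by [].
- exact: (subspaceD sN).
- exact: (subspaceZ _ sN).
- exact: normal_spanM.
Qed.

End WordValues.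

(** * Straightening *)

Section Straightening.
Variables (K : fieldType) (A : jordanAlgType K) (yv zv : nat -> A) (n : nat).
Hypotheses (nuc_y : forall i, nuclear (yv i))
           (nuc_zz : forall i j, nuclear (zv i ** zv j)).

Local Notation pair_val := (pair_val zv).
Local Notation word_val := (word_val yv zv).

Definition colourable_span : set A :=
  lspan [set word_val w | w in
    [set w | normal w /\ exists h, colouring n w.2 h]].

Hypothesis gpoly0 : forall (p : 'I_n -> nat) (q : 'I_n.+1 -> nat),
  \sum_(s : 'S_n.+1) (-1) ^+ s *:
    foldl (fun w i => w ** (zv (p i) ** zv (q (s (lift ord0 i)))))
          (zv (q (s ord0))) (enum 'I_n) = 0.

Definition permuted_chain (p q : 'I_n.+1 -> nat) (s : 'S_n.+1) :=
  [seq (p a, q (s a)) | a <- enum 'I_n.+1].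

Lemma zeros_permuted_chain p q s :
  zeros (permuted_chain p q s) = zeros (permuted_chain p q 1%g).
Proof.
rewrite /zeros /permuted_chain big_map [RHS]big_map !big_enum !big_split /=; congr (_ + _)%N.
rewrite [RHS](reindex_inj (@perm_inj _ s)) /=.
by apply: eq_bigr => a _; rewrite perm1.
Qed.

(** When [p ord0 = 0] the left-hand side is the given relation, a determinant
    with one column of odd variables; otherwise it is the product of such a
    determinant by an odd variable, which is a minor of the matrix of the products
    [z_i z_j]. *)
Lemma minor_relation (p q : 'I_n.+1 -> nat) :
  (forall a, a != ord0 -> p a != 0%N) -> (forall a, q a != 0%N) ->
  \sum_(s : 'S_n.+1) (-1) ^+ s *: word_val ([::], permuted_chain p q s) = 0.
Proof.
move=> p0 q0; pose q' a := (q a).-1; pose p' i := (p (lift ord0 i)).-1.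
have zq a : zval zv (q a) = zv (q' a) by rewrite /q'; case: (q a) (q0 a).
have zp i : zval zv (p (lift ord0 i)) = zv (p' i).
  by have := p0 (lift ord0 i) isT; rewrite /p'; case: (p _).
transitivity ((\sum_(s : 'S_n.+1) (-1) ^+ s *:
    foldl (fun w i => w ** (zv (p' i) ** zv (q' (s (lift ord0 i)))))
          (zv (q' (s ord0))) (enum 'I_n)) ** zval zv (p ord0)); last first.
  by rewrite gpoly0 jmul0l.
rewrite jmul_suml; apply: eq_bigr => s _; rewrite jmulZl; congr (_ *: _).
rewrite (foldl_jmul (f := fun i => zv (p' i) ** zv (q' (s (lift ord0 i))))) //.
rewrite /word_val /factors /permuted_chain cats0 enum_ordSl /= /pair_val /= zq.
set J := jprod _; set J' := jprod _.
have -> : J = J'.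
  congr jprod; rewrite -!map_comp; apply: eq_map => i /=.
  by rewrite /pair_val /= zp zq.
have nJ : nuclear J'.
  by apply: (jprod_nuclear (bad := pred0)) => [i _|]; rewrite ?count_pred0.
by rewrite [RHS]jmulC (nuclearAr _ _ nJ).
Qed.

Lemma minor_relation_word (p q : 'I_n.+1 -> nat) ys R :
  (forall a, a != ord0 -> p a != 0%N) -> (forall a, q a != 0%N) ->
  (zeros (permuted_chain p q 1%g ++ R) <= 1)%N ->
  \sum_(s : 'S_n.+1) (-1) ^+ s *: word_val (ys, permuted_chain p q s ++ R) = 0.
Proof.
move=> p0 q0 zR.
transitivity ((\sum_(s : 'S_n.+1) (-1) ^+ s *:
  word_val ([::], permuted_chain p q s)) ** word_val (ys, R)); last first.
  by rewrite minor_relation // jmul0l.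
rewrite jmul_suml; apply: eq_bigr => s _; rewrite jmulZl; congr (_ *: _).
by rewrite word_val_cat // zeros_permuted_chain -zeros_cat.
Qed.

(** A word which contains a chain of length [n.+1] is the main diagonal term of
    a minor relation; by the rearrangement inequality the other terms have
    smaller weight. *)
Lemma straightening w : (zeros w.2 <= 1)%N -> colourable_span (word_val w).
Proof.
have sC : subspace colourable_span by exact: lspan_subspace.
have [N] := ubnP (pair_wt w.2); elim: N w => [//|N IHN] w wN zw.
rewrite -(word_val_normal_form nuc_y nuc_zz zw).
have nw := normal_form_normal zw.
have : (pair_wt (normal_form w).2 < N.+1)%N.
  by rewrite (perm_pair_wt (perm_normal_form w)) pair_wt_order.
move: (normal_form w) nw => {w wN zw} [ys L] nL /= LN.
have [[h hL]|[c [sc cs cL]]] := colouring_or_chain n L.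
  by apply: sub_lspan; exists (ys, L) => //; split=> //; exists h.
have [R LE] : exists R, perm_eq L (c ++ R).
  have uc : uniq c.
    by apply: (sorted_uniq pair_lt_trans) cs => x; rewrite /pair_lt ltnn.
  have [c' c'L cc'] : exists2 s, subseq s L & perm_eq c s.
    by apply/count_subseqP => x; exact: leq_uniq_count.
  have [R LR] := perm_to_subseq c'L; exists R; apply: perm_trans LR _.
  by rewrite perm_cat2r perm_sym.
case/and4P: nL => /= _ _ oL zL.
pose p (a : 'I_n.+1) := (nth (0, 0)%N c a).1.
pose q (a : 'I_n.+1) := (nth (0, 0)%N c a).2.
have pq (a b : 'I_n.+1) : (a < b)%N -> (p a < p b)%N /\ (q a < q b)%N.
  move=> ab; apply/andP.
  by apply: (sorted_ltn_nth pair_lt_trans) => //; rewrite inE sc.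
have ltp : {homo p : a b / (a < b)%N} by move=> a b /pq[].
have ltq : {homo q : a b / (a < b)%N} by move=> a b /pq[].
have cE : c = permuted_chain p q 1%g.
  apply: (@eq_from_nth _ (0, 0)%N); first by rewrite size_map size_enum_ord.
  rewrite sc => i lin; rewrite (nth_map ord0) ?size_enum_ord // perm1.
  by rewrite /p /q nth_enum_ord // -surjective_pairing.
have p0 a : a != ord0 -> p a != 0%N.
  move=> a0; have /pq[] : (@ord0 n < a)%N by rewrite lt0n.
  by case: (p a).
have q0 a : q a != 0%N.
  have caL : nth (0, 0)%N c a \in L by apply: cL; rewrite mem_nth ?sc.
  move: zL; rewrite (perm_zeros (perm_to_rem caL)) zeros_cons.
  by have := allP oL _ caL; rewrite /q; lia.
rewrite (word_val_perm nuc_y nuc_zz _ (perm_refl ys) LE) // cE.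
have zR : (zeros (permuted_chain p q 1%g ++ R) <= 1)%N.
  by rewrite -cE -(perm_zeros LE).
have := minor_relation_word ys p0 q0 zR.
rewrite (bigD1 1%g) //= odd_perm1 expr0 scale1r => /eqP; rewrite addr_eq0 => /eqP->.
rewrite -scaleN1r; apply: (subspaceZ _ sC); apply: (subspace_sum _ sC) => s s1.
apply: (subspaceZ _ sC); apply: IHN => /=; last first.
  by rewrite zeros_cat zeros_permuted_chain -zeros_cat.
apply: leq_trans (_ : pair_wt L <= _)%N; last by rewrite -ltnS.
rewrite (perm_pair_wt LE) cE !pair_wt_cat ltn_add2r.
rewrite /pair_wt /permuted_chain big_map [X in (_ < X)%N]big_map !big_enum /=.
under [X in (_ < X)%N]eq_bigr do rewrite perm1.
exact: rearrangement.
Qed.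

Lemma colourable_span_eval t :
  colourable_span
    (jterm_eval (fun x : gvar => if x.1 then zv x.2 else yv x.2) t).
Proof.
apply: (lspan_ind (lspan_subspace _)) (normal_span_eval nuc_y nuc_zz t).
by move=> _ [w /and4P[_ _ _ zw] <-]; exact: straightening.
Qed.

End Straightening.

(** * Linear independence of colourable words *)

Lemma seq_argmax (T : eqType) (f : T -> nat) (s : seq T) x0 :
  x0 \in s -> exists2 m, m \in s & {in s, forall x, (f x <= f m)%N}.
Proof.
elim: s x0 => [//|y s IHs] x0 _.
have [->|[x1 /IHs[m ms mmax]]] : s = [::] \/ exists x1, x1 \in s.
- by case: (s) => [|x1 t]; [left|right; exists x1; rewrite mem_head].
- by exists y; rewrite ?mem_head // => x; rewrite inE => /eqP ->.
have [le|lt] := leqP (f y) (f m).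
  exists m; first by rewrite inE ms orbT.
  by move=> x; rewrite inE => /predU1P[->|/mmax].
exists y; first exact: mem_head.
move=> x; rewrite inE => /predU1P[->//|/mmax xm].
exact: leq_trans xm (ltnW lt).
Qed.

Section WordIndependence.
Variables (K : fieldType) (Kinf : infinite_set [set: K]).
Variables (n : nat) (d : nat -> K).
Hypothesis d_neq0 : forall k, (k < n)%N -> d k != 0.

(** The value of a word at even scalars [alpha] and vectors with coordinates [a]
    in an orthogonal basis with norms [d]; an isolated odd variable is replaced
    by its scalar product with the vector of index 0. *)
Definition word_fun (alpha : nat -> K) (a : nat -> nat -> K) (w : word) : K :=
  (\prod_(i <- w.1) alpha i) *
  \prod_(x <- w.2) \sum_(k <- iota 0 n) d k * a x.1 k * a x.2 k.

Definition word_exponent (ys : seq nat) (c : seq cpair) : seq (nat + nat * nat) :=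
  map inl ys ++ map inr (ccontent c).

Lemma word_fun_monom (x : nat + nat * nat -> K) w :
  word_fun (fun i => x (inl i)) (fun p k => x (inr (p, k))) w =
  \sum_(c <- colourings n w.2)
    (\prod_(y <- c) d y.2) * monom x (word_exponent w.1 c).
Proof.
rewrite /word_fun prod_sum_colourings mulr_sumr; apply: eq_bigr => c _.
rewrite /word_exponent monom_cat {1}/monom big_map mulrCA; congr (_ * _).
rewrite /monom big_map big_flatten big_map -big_split /=; apply: eq_bigr => y _.
by rewrite big_cons big_seq1 mulrA.
Qed.

Lemma perm_word_exponent ys ys' c c' :
  perm_eq (word_exponent ys c) (word_exponent ys' c') ->
  perm_eq ys ys' /\ perm_eq (ccontent c) (ccontent c').
Proof.
move=> /seq.permP E; split; apply/seq.permP => P.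
  have := E (fun t => if t is inl i then P i else false).
  by rewrite /word_exponent !count_cat !count_map !(eq_count (a2 := pred0)
    (_ : preim inr _ =1 _)) // !count_pred0 !addn0.
have := E (fun t => if t is inr i then P i else false).
by rewrite /word_exponent !count_cat !count_map !(eq_count (a2 := pred0)
  (_ : preim inl _ =1 _)) // !count_pred0.
Qed.

Definition colour_with (h : nat * nat -> nat) L : seq cpair :=
  [seq (x, h x) | x <- L].

(** A colour class of a colouring contains no two comparable pairs, so it is
    nested, and the coloured word is determined by its content among the words
    which are not heavier. *)
Lemma colour_with_unique w w' h c :
  normal w -> normal w' -> colouring n w.2 h -> c \in colourings n w'.2 ->
  (pair_wt w'.2 <= pair_wt w.2)%N ->
  perm_eq (word_exponent w'.1 c) (word_exponent w.1 (colour_with h w.2)) ->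
  w' = w /\ c = colour_with h w.2.
Proof.
move=> nw nw' [hn hlt]; rewrite mem_colourings => /andP[/eqP cw' cn] wt.
move=> /perm_word_exponent[ys pc].
have cK : unzip1 (colour_with h w.2) = w.2 by rewrite /unzip1 -map_comp map_id.
have /and4P[_ _ ow _] := nw; have /and4P[_ _ ow' _] := nw'.
have om : {in colour_with h w.2, forall x : cpair, x.1.1 <= x.1.2}%N.
  by move=> _ /mapP[x xw ->]; exact: (allP ow).
have oc : {in c, forall x : cpair, x.1.1 <= x.1.2}%N.
  by move=> x xc; apply: (allP ow'); rewrite -cw'; exact: map_f.
have nm : nested (colour_with h w.2).
  move=> _ _ /mapP[x xw ->] /mapP[y yw ->] /= hxy.
  by apply/negP => /(hlt x y xw yw); rewrite hxy eqxx.
have [le eq] := nested_min om oc nm pc; rewrite cK cw' in le eq.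
have cc : perm_eq c (colour_with h w.2).
  by apply: eq; apply/eqP; rewrite eqn_leq wt le.
have ww' : w' = w.
  apply: normal_perm_eq => //; rewrite -cw' -[w.2]cK; exact: perm_map.
split=> //; rewrite -ww' -cw' /colour_with -map_comp -[LHS]map_id.
apply/eq_in_map => x; rewrite (perm_mem cc) => /mapP[z _ ->] //.
Qed.

(** In a nontrivial relation, colour properly a word of maximal weight among those
    with nonzero coefficient: by [colour_with_unique] its monomial appears only
    once in the expansion of the relation. *)
Lemma word_fun_independent (s : seq word) (c : word -> K) :
  uniq s ->
  {in s, forall w, normal w /\ exists h, colouring n w.2 h} ->
  (forall alpha a, \sum_(w <- s) c w * word_fun alpha a w = 0) ->
  {in s, forall w, c w = 0}.
Proof.
move=> us ns c0 w0 w0s; apply: contrapT => /eqP cw0.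
have [M [Ms cM Mmax]] : exists M, [/\ M \in s, c M != 0 &
    {in s, forall w, c w != 0 -> (pair_wt w.2 <= pair_wt M.2)%N}].
  have w0f : w0 \in [seq w <- s | c w != 0] by rewrite mem_filter cw0.
  have [M] := seq_argmax (fun w : word => pair_wt w.2) w0f.
  rewrite mem_filter => /andP[cM Ms] Mmax; exists M; split=> // w ws cw.
  by apply: Mmax; rewrite mem_filter cw.
have [nM [h hM]] := ns M Ms.
pose lM := word_exponent M.1 (colour_with h M.2).
pose r := [seq (c w * \prod_(y <- k) d y.2, word_exponent w.1 k) |
  w <- s, k <- colourings n w.2].
have r0 x : \sum_(m <- r) m.1 * monom x m.2 = 0.
  rewrite -[RHS](c0 (fun i => x (inl i)) (fun p k => x (inr (p, k)))).
  rewrite big_allpairs_dep; apply: eq_bigr => w _.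
  rewrite word_fun_monom mulr_sumr; apply: eq_bigr => k _.
  by rewrite mulrA.
have := monom_coef Kinf lM r0.
rewrite big_mkcond big_allpairs_dep (bigD1_seq M) //= [X in _ + X]big1_seq.
  rewrite addr0 (bigD1_seq (colour_with h M.2)) ?colourings_uniq //=; last first.
    rewrite mem_colourings /unzip1 -map_comp map_id eqxx all_map.
    by apply/allP=> x xM; exact: hM.1.
  rewrite perm_refl /= [X in _ + X]big1_seq ?addr0.
    move/eqP; rewrite mulf_eq0 (negbTE cM) /= prodf_seq_eq0 => /hasP[y].
    move=> /mapP[x xM ->] /= dx; have := d_neq0 (hM.1 x xM).
    by rewrite (negbTE (d_neq0 (hM.1 x xM))) in dx.
  move=> k /andP[kM kcol]; case: ifP => // /(colour_with_unique nM nM hM kcol).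
  by move=> /(_ (leqnn _))[_ kE]; rewrite kE eqxx in kM.
move=> w /andP[wM ws]; rewrite big1_seq // => k /= kcol; case: ifP => // wk.
have [-> |cw] := eqVneq (c w) 0; first by rewrite mul0r.
have [nw _] := ns w ws.
have [wE _] := colour_with_unique nM nw hM kcol (Mmax w ws cw) wk.
by rewrite wE eqxx in wM.
Qed.

End WordIndependence.

(** * Evaluation of words in the algebra of a form *)

Section HomWords.
Variables (K : fieldType) (A B : jordanAlgType K) (f : {linear A -> B}).
Hypothesis fH : jordan_hom f.

Lemma hom_jprod s : f (jprod s) = jprod (map f s).
Proof. by elim: s => [|x s IHs] /=; rewrite ?fH.1 // fH.2 IHs. Qed.

Lemma hom_word_val yv zv w :
  f (word_val yv zv w) = word_val (f \o yv) (f \o zv) w.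
Proof.
rewrite /word_val hom_jprod -map_comp; congr jprod; apply: eq_map => -[i|x] //=.
have fz p : f (zval zv p) = zval (f \o zv) p by case: p => //=; exact: fH.1.
by rewrite /pair_val fH.2 !fz.
Qed.

End HomWords.

Section FormWords.
Variables (K : fieldType) (V : lmodType K) (b : {symmetric V}).
Local Notation B := (form_alg b).

Lemma scalar_nuclear (u : B) : u.2 = 0 -> nuclear u.
Proof.
case: u => u1 u2 /= -> [v1 v2] [w1 w2]; congr pair => /=.
  rewrite !scaler0 !addr0 !linear0l !addr0 linearZl_LR /=.
  by rewrite mulrDr mulrA.
by rewrite !scaler0 !addr0 linear0l addr0 scalerDr !scalerA [w1 * u1]mulrC.
Qed.

Variables (n : nat) (e : nat -> V) (alpha : nat -> K) (a : nat -> nat -> K).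
Hypothesis e_orth : forall i j, (i < n)%N -> (j < n)%N -> i != j -> b (e i) (e j) = 0.

Let d k := b (e k) (e k).
Let v p := \sum_(k <- iota 0 n) a p k *: e k.
Let yv i : B := (alpha i, 0).
Let zv i : B := (0, v i.+1).

Lemma form_orth_sum p q : b (v p) (v q) = \sum_(k <- iota 0 n) d k * a p k * a q k.
Proof.
rewrite /v linear_sumlz big_seq_cond [RHS]big_seq_cond; apply: eq_bigr => k.
rewrite andbT mem_iota /= => kn; rewrite linearZl_LR linear_sumr /=.
rewrite (bigD1_seq k) ?iota_uniq ?mem_iota //= linearZr_LR /= big1_seq.
  by rewrite addr0 /d; ring.
move=> j; rewrite mem_iota /= => /andP[jk jn].
by rewrite linearZr_LR /= e_orth ?mulr0 // eq_sym.
Qed.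

Lemma form_word_val0 w : zeros w.2 = 0%N ->
  word_val yv zv w = (word_fun n d alpha a w, 0) :> B.
Proof.
case: w => ys L /=; elim: L => [_|[p q] L IHL].
  rewrite /word_fun big_nil mulr1 /word_val /factors /=.
  elim: ys => [|i ys IHys] /=; first by rewrite big_nil.
  by rewrite IHys big_cons; congr pair; rewrite /= ?linear0l ?addr0 ?scaler0 ?addr0.
rewrite zeros_cons /=; case: p q => [|p] [|q] // /IHL E.
rewrite word_val_cons E; congr pair => /=; last first.
  by rewrite !scaler0 !scale0r !addr0 scaler0 addr0.
rewrite !linear0r addr0.
by rewrite mul0r add0r form_orth_sum /word_fun big_cons /= mulrCA.
Qed.

Lemma form_word_val w : normal w ->
  (word_val yv zv w).1 + b (v 0) (word_val yv zv w).2 = word_fun n d alpha a w.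
Proof.
case: w => ys L /and4P[_ _ /= oL].
rewrite leq_eqVlt ltnS leqn0 => /orP[]/eqP zL; last first.
  by rewrite form_word_val0 //= linear0r addr0.
have [q [R [LE zR]]] := zeros1_split oL zL.
have nuc_y i : nuclear (yv i) by exact: scalar_nuclear.
have nuc_zz i j : nuclear (zv i ** zv j).
  by apply: scalar_nuclear; rewrite /= !scale0r addr0.
rewrite (word_val_perm nuc_y nuc_zz _ (perm_refl ys) LE) ?zL //.
rewrite word_val_cons form_word_val0 //= /word_fun /= (perm_big _ LE) big_cons /=.
rewrite !(linear0l, linear0r, scale0r, scaler0, mul0r, mulr0, add0r, addr0, mul1r, scale1r).
by rewrite linearZr_LR /= form_orth_sum /=; ring.
Qed.

End FormWords.

(** * Quotients of the free Jordan algebra *)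

Section JordanQuotient.
Local Open Scope quotient_scope.
Variables (K : fieldType) (I : set (JX K)).
Local Notation A := (JX K).
Hypothesis idealI : jordan_ideal I.

Let sI : subspace I. Proof. exact: idealI.1. Qed.

Definition ideal_eqb (u v : A) : bool := `[< I (u - v) >].

Fact ideal_eqb_refl : reflexive ideal_eqb.
Proof. by move=> u; apply/asboolP; rewrite subrr; exact: sI.1. Qed.

Fact ideal_eqb_sym : symmetric ideal_eqb.
Proof.
move=> u v; apply/asboolP/asboolP => /(subspaceZ (-1) sI);
by rewrite scaleN1r opprB.
Qed.

Fact ideal_eqb_trans : transitive ideal_eqb.
Proof.
move=> v u w /asboolP uv /asboolP vw; apply/asboolP.
by have := subspaceD sI uv vw; rewrite addrA subrK.
Qed.

Canonical ideal_equiv :=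
  EquivRel ideal_eqb ideal_eqb_refl ideal_eqb_sym ideal_eqb_trans.

Definition jordan_quotient : Type := {eq_quot ideal_equiv}.
Local Notation Q := jordan_quotient.

HB.instance Definition _ := Choice.on Q.
HB.instance Definition _ := EqQuotient.on Q.

Definition jq_pi (u : A) : Q := \pi_Q u.

Lemma jq_piP u v : jq_pi u = jq_pi v <-> I (u - v).
Proof.
split=> [/eqmodP/asboolP//|uv].
by apply/eqmodP/asboolP.
Qed.

Lemma jq_repr u : I (repr (jq_pi u) - u).
Proof. by apply/jq_piP; rewrite /jq_pi reprK. Qed.

Lemma jq_ind (P : Q -> Prop) : (forall u, P (jq_pi u)) -> forall x, P x.
Proof. exact: quotW. Qed.

Definition jq_add (x y : Q) := jq_pi (repr x + repr y).
Definition jq_opp (x : Q) := jq_pi (- repr x).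
Definition jq_scale (a : K) (x : Q) := jq_pi (a *: repr x).
Definition jq_mul (x y : Q) := jq_pi (repr x ** repr y).

Fact jq_addE u v : jq_add (jq_pi u) (jq_pi v) = jq_pi (u + v).
Proof.
apply/jq_piP; rewrite opprD addrACA.
exact: (subspaceD sI (jq_repr u) (jq_repr v)).
Qed.

Fact jq_scaleE a u : jq_scale a (jq_pi u) = jq_pi (a *: u).
Proof. by apply/jq_piP; rewrite -scalerBr; exact: (subspaceZ _ sI (jq_repr u)). Qed.

Fact jq_oppE u : jq_opp (jq_pi u) = jq_pi (- u).
Proof. by apply/jq_piP; rewrite -opprD -scaleN1r; exact: (subspaceZ _ sI (jq_repr u)). Qed.

Fact jq_mulE u v : jq_mul (jq_pi u) (jq_pi v) = jq_pi (u ** v).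
Proof.
apply/jq_piP; set u' := repr _; set v' := repr _.
have -> : u' ** v' - u ** v = (u' - u) ** v' + (v' - v) ** u.
  rewrite ![(_ - _) ** _]jmulDl -!scaleN1r !jmulZl ![v' ** u]jmulC ![v ** u]jmulC.
  by rewrite !scaleN1r addrA subrK.
apply: (subspaceD sI); apply: idealI.2; exact: jq_repr.
Qed.

Let jqE := (jq_addE, jq_scaleE, jq_oppE, jq_mulE).

Fact jq_addA : associative jq_add.
Proof.
by elim/jq_ind=> u; elim/jq_ind=> v; elim/jq_ind=> w; rewrite !jqE addrA.
Qed.

Fact jq_addC : commutative jq_add.
Proof. by elim/jq_ind=> u; elim/jq_ind=> v; rewrite !jqE addrC. Qed.

Fact jq_add0 : left_id (jq_pi 0) jq_add.
Proof. by elim/jq_ind=> u; rewrite jqE add0r. Qed.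

Fact jq_addN : left_inverse (jq_pi 0) jq_opp jq_add.
Proof. by elim/jq_ind=> u; rewrite !jqE addNr. Qed.

HB.instance Definition _ :=
  GRing.isZmodule.Build Q jq_addA jq_addC jq_add0 jq_addN.

Fact jq_scaleA a b (x : Q) : jq_scale a (jq_scale b x) = jq_scale (a * b) x.
Proof. by elim/jq_ind: x => u; rewrite !jqE scalerA. Qed.

Fact jq_scale1 : left_id 1 jq_scale.
Proof. by elim/jq_ind=> u; rewrite jqE scale1r. Qed.

Fact jq_scaleDr : right_distributive jq_scale +%R.
Proof.
move=> a; elim/jq_ind=> u; elim/jq_ind=> v.
by rewrite /GRing.add /= !jqE scalerDr.
Qed.

Fact jq_scaleDl (x : Q) : {morph jq_scale^~ x : a b / a + b}.
Proof.
move=> a b; elim/jq_ind: x => u.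
by rewrite [in RHS]/GRing.add /= !jqE scalerDl.
Qed.

HB.instance Definition _ := GRing.Zmodule_isLmodule.Build K Q
  jq_scaleA jq_scale1 jq_scaleDr jq_scaleDl.

Fact jq_mulC : commutative jq_mul.
Proof. by elim/jq_ind=> u; elim/jq_ind=> v; rewrite !jqE jmulC. Qed.

Fact jq_mulPl (a : K) (x y z : Q) :
  jq_mul (a *: x + y) z = a *: jq_mul x z + jq_mul y z.
Proof.
elim/jq_ind: x => u; elim/jq_ind: y => v; elim/jq_ind: z => w.
by rewrite /GRing.add /GRing.scale /= !jqE jmulPl.
Qed.

Fact jq_mul1l : left_id (jq_pi jone) jq_mul.
Proof. by elim/jq_ind=> u; rewrite jqE jmul1l. Qed.

Fact jq_jordan (x y : Q) :
  jq_mul (jq_mul (jq_mul x x) y) x = jq_mul (jq_mul x x) (jq_mul y x).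
Proof.
by elim/jq_ind: x => u; elim/jq_ind: y => v; rewrite !jqE jordan_identity.
Qed.

HB.instance Definition _ := isJordanAlg.Build K Q
  jq_mulC jq_mulPl jq_mul1l jq_jordan.

Fact jq_pi_linear : linear jq_pi.
Proof. by move=> a u v; rewrite [in RHS]/GRing.add [in RHS]/GRing.scale /= !jqE. Qed.

HB.instance Definition _ :=
  GRing.isLinear.Build K A Q _ jq_pi jq_pi_linear.

Lemma jq_pi_hom : jordan_hom jq_pi.
Proof. by split=> // u v; rewrite [in RHS]/jmul /= jq_mulE. Qed.

Lemma jq_piM : {morph jq_pi : u v / u ** v}.
Proof. exact: jq_pi_hom.2. Qed.

Lemma jq_pi0 u : jq_pi u = 0 <-> I u.
Proof. by rewrite jq_piP subr0. Qed.

End JordanQuotient.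

(** * Graded T-ideals *)

Section EvalRules.
Variables (K : fieldType) (A : jordanAlgType K) (rho : gvar -> A).

Lemma fj_evalM : {morph fj_eval rho : u v / u ** v}.
Proof. exact: (fj_eval_hom rho).2. Qed.

Lemma fj_eval1 : fj_eval rho jone = jone.
Proof. exact: (fj_eval_hom rho).1. Qed.

Lemma fj_eval_x a i : fj_eval rho (xvar K a i) = rho (a, i).
Proof. exact: fj_eval_gen. Qed.

End EvalRules.

Section GradedEvaluation.
Variables (K : fieldType) (A : jordanAlgType K) (G : bool -> set A).
Hypotheses (gradG : is_z2grading G) (G1 : G false jone).

Lemma graded_eval (rho : gvar -> A) a u :
  (forall x, G x.1 (rho x)) -> JX_grading a u -> G a (fj_eval rho u).
Proof.
case: gradG => sG _ _ MG Grho.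
apply: (lspan_ind (W := [set u | G a (fj_eval rho u)])).
  split=> [|c v w Gv Gw] /=; first by rewrite linear0; exact: (sG a).1.
  by rewrite linearP; exact: (sG a).2.
move=> x /=; elim=> {x} [|{}a i|{}a b v w _ Gv _ Gw].
- by rewrite fj_eval1.
- by rewrite fj_eval_x; exact: (Grho (a, i)).
- by rewrite fj_evalM; exact: MG.
Qed.

End GradedEvaluation.

Lemma JX_gradingX (K : fieldType) a i : JX_grading a (xvar K a i).
Proof. by apply: sub_lspan; exact: jmonomial_var. Qed.

Lemma JX_grading1 (K : fieldType) : JX_grading (K := K) false jone.
Proof. by apply: sub_lspan; exact: jmonomial_one. Qed.

Lemma JX_gradingM (K : fieldType) a b (u v : JX K) :
  JX_grading a u -> JX_grading b v -> JX_grading (a (+) b) (u ** v).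
Proof.
apply: lspan_mul; first exact: lspan_subspace.
by move=> {}u {}v mu mv; apply: sub_lspan; exact: jmonomial_mul.
Qed.

Lemma graded_identities_T_ideal (K : fieldType) (A : jordanAlgType K)
    (G : bool -> set A) :
  is_z2grading G -> G false jone -> graded_T_ideal (graded_identities G).
Proof.
move=> gradG G1; split; first split; first split.
- by move=> rho _; rewrite linear0.
- by move=> a u v Iu Iv rho Grho; rewrite linearP /= Iu // Iv // scaler0 addr0.
- move=> u v Iu rho Grho; by rewrite fj_evalM Iu // jmul0l.
move=> f [[f1 fM] fG] u Iu rho Grho.
pose rho' x := fj_eval rho (f (fj_gen K x)).
have -> : fj_eval rho (f u) = fj_eval rho' u.
  apply: (fj_eval_unique (f := fj_eval rho \o f)) => //.
  by split=> [|v w] /=; [rewrite f1 fj_eval1 | rewrite fM fj_evalM].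
apply: Iu => x; apply: (graded_eval gradG G1 Grho).
by apply: fG; case: (x) => a i; exact: JX_gradingX.
Qed.

Section TIdeals.
Variables (K : fieldType) (char_neq2 : 2%N \notin [pchar K]).
Local Notation JX := (JX K).
Variable I : set JX.
Hypothesis TI : graded_T_ideal I.

Lemma T_ideal_subst (rho : gvar -> JX) u :
  (forall x, JX_grading x.1 (rho x)) -> I u -> I (fj_eval rho u).
Proof.
move=> Grho Iu; apply: (TI.2 (fj_eval rho)) => //; split.
  exact: fj_eval_hom.
move=> a v; apply: graded_eval => //; first exact: JX_grading_is_grading.
exact: JX_grading1.
Qed.

(** Both arguments are sums of an even and of an odd element, and each of the
    four resulting associators is a graded substitution instance of one of the
    generators. *)
Lemma y_associators_nuclear : y_associators K `<=` I ->
  forall e, JX_grading false e -> nuclear (jq_pi TI.1 e).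
Proof.
move=> yI e Ee; elim/jq_ind => u; elim/jq_ind => v.
suff /(jq_piP TI.1) : I ((e ** u) ** v - e ** (u ** v)) by rewrite !jq_piM.
rewrite -/(associator e u v).
have [_ dec _ _] := JX_grading_is_grading char_neq2.
have Iabc a b u' v' : JX_grading a u' -> JX_grading b v' -> I (associator e u' v').
  move=> Gu Gv.
  pose rho (x : gvar) : JX := if x == (false, 0%N) then e else
    if x == (a, 1%N) then u' else if x == (b, 2%N) then v' else xvar K x.1 x.2.
  have Grho x : JX_grading x.1 (rho x).
    rewrite /rho; case: eqP => [->//|_]; case: eqP => [->//|_].
    by case: eqP => [->//|_]; exact: JX_gradingX.
  have : I (associator (yvar K 0) (xvar K a 1) (xvar K b 2)) by apply: yI; exists a, b.
  move=> /(T_ideal_subst Grho).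
  rewrite /associator linearB /= !fj_evalM !fj_eval_x /rho !xpair_eqE !eqxx.
  by rewrite !andbF.
have [u0 [u1 [Gu0 Gu1 ->]]] := dec u.
have [v0 [v1 [Gv0 Gv1 ->]]] := dec v.
have sI : subspace I := TI.1.1.
have aDl w : associator e (u0 + u1) w = associator e u0 w + associator e u1 w.
  by rewrite /associator jmulDr !jmulDl jmulDr opprD addrACA.
have aDr w : associator e w (v0 + v1) = associator e w v0 + associator e w v1.
  by rewrite /associator !jmulDr opprD addrACA.
rewrite aDl !aDr; apply: (subspaceD sI); apply: (subspaceD sI).
- exact: Iabc Gu0 Gv0.
- exact: Iabc Gu0 Gv1.
- exact: Iabc Gu1 Gv0.
- exact: Iabc Gu1 Gv1.
Qed.

End TIdeals.

(** * Reduction of polynomials to colourable words *)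

Section Reduction.
Variables (K : fieldType) (char_neq2 : 2%N \notin [pchar K]).
Local Notation JX := (JX K).
Variable I : set JX.
Hypotheses (TI : graded_T_ideal I) (yI : y_associators K `<=` I).

Let yv i : jordan_quotient TI.1 := jq_pi TI.1 (yvar K i).
Let zv i : jordan_quotient TI.1 := jq_pi TI.1 (zvar K i).

Lemma quotient_y_nuclear i : nuclear (yv i).
Proof. by apply: y_associators_nuclear => //; exact: JX_gradingX. Qed.

Lemma quotient_zz_nuclear i j : nuclear (zv i ** zv j).
Proof.
rewrite /zv -jq_piM; apply: y_associators_nuclear => //.
by apply: (@JX_gradingM _ true true); exact: JX_gradingX.
Qed.

Lemma quotient_evalE f : jq_pi TI.1 f =
  jterm_eval (fun x : gvar => if x.1 then zv x.2 else yv x.2) (repr f).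
Proof.
apply: (fj_eval_unique (f := jq_pi TI.1) _ _ f); first exact: jq_pi_hom.
by case=> [[] i].
Qed.

Lemma quotient_span_sum (P : set word) f :
  lspan [set word_val yv zv w | w in P] (jq_pi TI.1 f) ->
  exists s (c : word -> K), [/\ uniq s, {in s, forall w, P w} &
    I (f - \sum_(w <- s) c w *: word_val (yvar K) (zvar K) w)].
Proof.
move=> /lspan_uniq_sum[s [c [us Ps fE]]]; exists s, c; split=> //.
apply/(jq_piP TI.1); rewrite fE linear_sum; apply: eq_bigr => w _.
by rewrite linearZ /= (hom_word_val (jq_pi_hom TI.1)).
Qed.

Lemma normal_reduction f :
  exists s (c : word -> K), [/\ uniq s, {in s, forall w, normal w} &
    I (f - \sum_(w <- s) c w *: word_val (yvar K) (zvar K) w)].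
Proof.
apply: quotient_span_sum; rewrite quotient_evalE.
exact: (normal_span_eval quotient_y_nuclear quotient_zz_nuclear).
Qed.

(** The odd variables of [gpoly] are distinct, so an arbitrary choice of indices
    comes from a graded substitution. *)
Lemma gpoly_relation n : I (gpoly K n) ->
  forall (p : 'I_n -> nat) (q : 'I_n.+1 -> nat),
  \sum_(s : 'S_n.+1) (-1) ^+ s *:
    foldl (fun w i => w ** (zv (p i) ** zv (q (s (lift ord0 i)))))
          (zv (q (s ord0))) (enum 'I_n) = 0.
Proof.
move=> gI p q.
pose r k := if insub k is Some a then q a
            else if insub (k - n.+1)%N is Some i then p i else 0%N.
have rq (a : 'I_n.+1) : r a = q a by rewrite /r valK.
have rp (i : 'I_n) : r (n.+1 + i)%N = p i.
  by rewrite /r insubN ?addKn ?valK // -leqNgt leq_addr.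
pose rho (x : gvar) : JX := if x.1 then zvar K (r x.2) else yvar K x.2.
have Grho x : JX_grading x.1 (rho x).
  by rewrite /rho; case: x => -[] i; exact: JX_gradingX.
have /(jq_pi0 TI.1) := T_ideal_subst char_neq2 TI Grho gI.
rewrite /gpoly !linear_sum => E; rewrite -[RHS]E; apply: eq_bigr => s _.
rewrite !linearZ /=; congr (_ *: _).
have rz i : fj_eval rho (zvar K i) = zvar K (r i) by rewrite fj_eval_x.
rewrite -(rq (s ord0)) /zv -rz; elim: (enum _) (zvar K (s ord0)) => [//|i t IHt] u.
by rewrite /= -IHt -(rp i) -(rq (s (lift ord0 i))) -!rz !fj_evalM !jq_piM.
Qed.

Lemma colourable_reduction n f : I (gpoly K n) ->
  exists s (c : word -> K), [/\ uniq s,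
    {in s, forall w, normal w /\ exists h, colouring n w.2 h} &
    I (f - \sum_(w <- s) c w *: word_val (yvar K) (zvar K) w)].
Proof.
move=> gI; apply: quotient_span_sum; rewrite quotient_evalE.
apply: (colourable_span_eval quotient_y_nuclear quotient_zz_nuclear).
exact: gpoly_relation.
Qed.

End Reduction.

(** * Identities of the algebra of a form *)

Section FormIdentities.
Variables (K : fieldType) (Kinf : infinite_set [set: K]).
Variables (V : lmodType K) (b : {symmetric V}).
Local Notation Id := (graded_identities (scalar_grading b)).

Lemma form_identities_T_ideal : graded_T_ideal Id.
Proof.
by apply: graded_identities_T_ideal => //; exact: scalar_grading_is_grading.
Qed.

Lemma y_associators_form : y_associators K `<=` Id.
Proof.
move=> _ [a [c ->]] rho Grho.
rewrite /associator linearB /= !fj_evalM !fj_eval_x scalar_nuclear ?subrr //.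
exact: (Grho (false, 0%N)).
Qed.

(** [Lambda (x, v) = x + b (v_0, v)] sends the values of words to the functions
    whose independence is known; the auxiliary vector [v_0] plays the role of
    the index [0]. *)
Lemma form_words_independent n (e : nat -> V) (s : seq word) (c : word -> K) :
  (forall i j, (i < n)%N -> (j < n)%N -> i != j -> b (e i) (e j) = 0) ->
  (forall i, (i < n)%N -> b (e i) (e i) != 0) ->
  uniq s -> {in s, forall w, normal w /\ exists h, colouring n w.2 h} ->
  Id (\sum_(w <- s) c w *: word_val (yvar K) (zvar K) w) ->
  {in s, forall w, c w = 0}.
Proof.
move=> e_orth e_neq0 us sP Ids.
apply: (word_fun_independent Kinf e_neq0 us sP) => alpha a.
pose v p := \sum_(k <- iota 0 n) a p k *: e k.
pose yv i : form_alg b := (alpha i, 0).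
pose zv i : form_alg b := (0, v i.+1).
pose rho (x : gvar) := if x.1 then zv x.2 else yv x.2.
pose Lambda (u : form_alg b) : K := u.1 + b (v 0%N) u.2.
have LambdaP k u u' : Lambda (k *: u + u') = k * Lambda u + Lambda u'.
  by rewrite /Lambda /= linearPr /= {1}/GRing.scale /=; ring.
have : Lambda (fj_eval rho (\sum_(w <- s) c w *: word_val (yvar K) (zvar K) w)) = 0.
  rewrite Ids; first by rewrite /Lambda /= linear0r addr0.
  by move=> [[] i].
have -> : fj_eval rho (\sum_(w <- s) c w *: word_val (yvar K) (zvar K) w) =
    \sum_(w <- s) c w *: word_val yv zv w.
  rewrite linear_sum; apply: eq_bigr => w _; rewrite linearZ /=; congr (_ *: _).
  rewrite (hom_word_val (fj_eval_hom rho)).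
  by congr (word_val _ _ w); apply: funext => i /=; rewrite fj_eval_x.
move=> L0; rewrite -[RHS]L0; elim: s {us Ids L0} sP => [|w s IHs] sP.
  by rewrite !big_nil /Lambda /= linear0r addr0.
rewrite !big_cons LambdaP IHs; last by move=> w' w's; apply: sP; rewrite inE w's orbT.
have [nw _] := sP w (mem_head _ _).
by rewrite -(form_word_val _ _ e_orth nw).
Qed.

Lemma form_identity_mem n (e : nat -> V) (I : set (JX K)) f s (c : word -> K) :
  (forall i j, (i < n)%N -> (j < n)%N -> i != j -> b (e i) (e j) = 0) ->
  (forall i, (i < n)%N -> b (e i) (e i) != 0) ->
  I `<=` Id -> Id f -> uniq s ->
  {in s, forall w, normal w /\ exists h, colouring n w.2 h} ->
  I (f - \sum_(w <- s) c w *: word_val (yvar K) (zvar K) w) -> I f.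
Proof.
move=> e_orth e_neq0 IId Idf us sP Ifs; have [[sId _] _] := form_identities_T_ideal.
have Ids : Id (\sum_(w <- s) c w *: word_val (yvar K) (zvar K) w).
  have := subspaceD sId Idf (subspaceZ (-1) sId (IId _ Ifs)).
  by rewrite scaleN1r opprB addrCA subrr addr0.
have c0 := form_words_independent e_orth e_neq0 us sP Ids.
move: Ifs; rewrite big_seq big1 ?subr0 // => w ws.
by rewrite c0 // scale0r.
Qed.

End FormIdentities.

(** * Orthogonal families *)

Section OrthogonalFamilies.
Variables (K : fieldType) (char_neq2 : 2%N \notin [pchar K]).
Variables (V : lmodType K) (b : {symmetric V}).
Hypothesis b_nondeg : nondegenerate_form b.

(** If every vector orthogonal to an orthogonal family of nonisotropic vectors
    is isotropic, then, by polarization, the form vanishes on the orthogonal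
    complement; since it is nondegenerate, the family spans [V]. *)
Lemma orthogonal_extension (s : seq V) :
  {in s, forall u, b u u != 0} ->
  {in s &, forall u v, u != v -> b u v = 0} -> uniq s ->
  lspan [set` s] <> setT ->
  exists w, b w w != 0 /\ {in s, forall u, b u w = 0}.
Proof.
move=> s_neq0 s_orth us s_span; apply: contrapT => no_w; apply: s_span.
pose p v := v - \sum_(u <- s) (b u v / b u u) *: u.
have p_orth v : {in s, forall u, b u (p v) = 0}.
  move=> u0 u0s; rewrite /p linearBr /= linear_sumr (bigD1_seq u0) //= big1_seq.
    by rewrite addr0 linearZr_LR /= divfK ?s_neq0 // subrr.
  by move=> u /andP[uN us']; rewrite linearZr_LR /= (s_orth u0 u) ?mulr0 // eq_sym.
have iso w : {in s, forall u, b u w = 0} -> b w w = 0.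
  by move=> ws; apply: contrapT => /eqP bw; apply: no_w; exists w.
have two_neq0 : 2 != 0 :> K by move: char_neq2; rewrite inE.
have bDr u x y : b u (x + y) = b u x + b u y by rewrite linearDr.
have polarize x y : b x x = 0 -> b y y = 0 -> b (x + y) (x + y) = 0 -> b x y = 0.
  move=> xx yy; rewrite linearDl /= !linearDr /= xx yy add0r addr0.
  rewrite [b y x]form_sym -mulr2n -mulr_natl.
  by move=> /eqP; rewrite mulf_eq0 (negbTE two_neq0) => /eqP.
have polar v w : b (p v) (p w) = 0.
  apply: polarize; try exact: iso (p_orth _).
  by apply: iso => u us'; rewrite (bDr _ (p v)) !p_orth // addr0.
have p0 v : p v = 0.
  apply: b_nondeg => w.
  have -> : w = p w + \sum_(u <- s) (b u w / b u u) *: u by rewrite subrK.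
  rewrite (bDr _ (p w)) polar add0r linear_sumr big1_seq // => u /andP[_ us'].
  by rewrite linearZr_LR /= [b (p v) u]form_sym p_orth // mulr0.
rewrite -subTset => v _; have := p0 v; move/eqP; rewrite subr_eq0 => /eqP ->.
have sS := lspan_subspace [set` s].
rewrite big_seq; apply: (subspace_sum _ sS) => u us'.
by apply: (subspaceZ _ sS); exact: sub_lspan.
Qed.

Lemma orthogonal_family n :
  (forall s : seq V, (size s < n)%N -> lspan [set` s] <> setT) ->
  exists e : nat -> V,
    (forall i j, (i < n)%N -> (j < n)%N -> i != j -> b (e i) (e j) = 0) /\
    (forall i, (i < n)%N -> b (e i) (e i) != 0).
Proof.
move=> no_span.
suff [s [ss s_neq0 s_orth us]] : exists s : seq V, [/\ size s = n,
    {in s, forall u, b u u != 0},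
    {in s &, forall u v, u != v -> b u v = 0} & uniq s].
  exists (nth 0 s); split=> [i j|i]; rewrite -ss => iin.
    by move=> jin ij; apply: s_orth; rewrite ?mem_nth // nth_uniq.
  by apply: s_neq0; rewrite mem_nth.
elim: {1 3}n (leqnn n) => [_|m IHm mn]; first by exists [::].
have [s [ss s_neq0 s_orth us]] := IHm (ltnW mn).
have [w [w_neq0 sw]] : exists w, b w w != 0 /\ {in s, forall u, b u w = 0}.
  by apply: orthogonal_extension => //; apply: no_span; rewrite ss.
exists (w :: s); split; first by rewrite /= ss.
- by move=> u; rewrite inE => /predU1P[->//|/s_neq0].
- move=> u v; rewrite !inE => /predU1P[->|us'] /predU1P[->|vs'].
  + by rewrite eqxx.
  + by rewrite form_sym sw.
  + by rewrite sw.
  + exact: s_orth.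
- rewrite /= us andbT; apply: contraNN w_neq0 => ws.
  by rewrite sw.
Qed.

End OrthogonalFamilies.

Lemma vect_no_small_span (K : fieldType) (V : vectType K) (s : seq V) :
  (size s < \dim {:V})%N -> lspan [set` s] <> setT.
Proof.
move=> sn sT; move: sn; apply/negP; rewrite -leqNgt.
apply: leq_trans (dim_span s); apply: dimvS; apply/subvP => v _.
have : lspan [set` s] v by rewrite sT.
apply: (lspan_ind (W := [set v | v \in <<s>>%VS])) => [|u /= us].
  by split=> [|a u w /= us ws] /=; [exact: mem0v | rewrite memvD ?memvZ].
exact: memv_span.
Qed.

(** * The alternating polynomial in dimension [n] *)

(** Each coordinate of a value of [gpoly] is the determinant of a matrix of size
    [n.+1], for [n] the dimension, whose columns are given by linear forms
    evaluated at the same [n.+1] vectors; such a matrix has rank at most [n]. *)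
Lemma gpoly_form_identity (K : fieldType) (V : vectType K) (b : {symmetric V}) :
  graded_identities (scalar_grading b) (gpoly K (\dim {:V})).
Proof.
set n := \dim {:V}; move=> rho Grho.
pose v k : V := (rho (true, k)).2.
have zE k : fj_eval rho (zvar K k) = (0, v k).
  rewrite fj_eval_x; have := Grho (true, k); rewrite /v /=.
  by case: (rho _) => x y /= ->.
pose B (s : 'S_n.+1) (i : 'I_n) := b (v (n.+1 + i)%N) (v (s (lift ord0 i))).
have foldE (s : 'S_n.+1) (t : seq 'I_n) (u : JX K) (x : V) :
    fj_eval rho u = (0, x) ->
    fj_eval rho (foldl (fun (w : JX K) (i : 'I_n) =>
      w ** (zvar K (n.+1 + i) ** zvar K (s (lift ord0 i)))) u t) =
    (0, (\prod_(i <- t) B s i) *: x).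
  elim: t u x => [|i t IHt] u x uE /=; first by rewrite big_nil scale1r.
  rewrite (IHt _ (B s i *: x)); first by rewrite big_cons mulrC scalerA.
  rewrite !fj_evalM uE !zE; congr pair => /=.
    by rewrite !(scale0r, scaler0, addr0, linear0r, mul0r).
  by rewrite !(scale0r, scaler0, add0r, addr0, mul0r).
have -> : fj_eval rho (gpoly K n) = \sum_(s : 'S_n.+1)
    (-1) ^+ s *: ((0, (\prod_(i <- enum 'I_n) B s i) *: v (s ord0)) : form_alg b).
  rewrite /gpoly linear_sum; apply: eq_bigr => s _; rewrite linearZ /=.
  by rewrite (foldE s _ _ _ (zE _)).
suff : \sum_(s : 'S_n.+1) (-1) ^+ s *: ((\prod_(i < n) B s i) *: v (s ord0)) = 0.
  move=> E; transitivity ((0, \sum_(s : 'S_n.+1) (-1) ^+ s *: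
      ((\prod_(i < n) B s i) *: v (s ord0))) : form_alg b); last by rewrite E.
  rewrite (eq_bigr (fun s : 'S_n.+1 => ((0, (-1) ^+ s *:
      ((\prod_(i < n) B s i) *: v (s ord0))) : form_alg b))); last first.
    by move=> s _; rewrite big_enum; congr pair; rewrite /= ?scaler0.
  apply: (big_ind2 (fun (x : form_alg b) (y : V) => x = (0, y))) => //.
  by move=> _ y _ y' -> ->; congr pair; rewrite /= addr0.
pose X := vbasis {:V}.
suff coord0 l : coord X l (\sum_(s : 'S_n.+1) (-1) ^+ s *:
    ((\prod_(i < n) B s i) *: v (s ord0))) = 0.
  rewrite [LHS](coord_vbasis (memvf _)) big1 // => l _.
  by rewrite coord0 scale0r.
pose P : 'M[K]_(n.+1, n) := \matrix_(a, k) coord X k (v a).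
pose Q : 'M[K]_(n, n.+1) := \matrix_(k, c)
  if unlift ord0 c is Some i then b (v (n.+1 + i)%N) X`_k else (k == l)%:R.
have det0 : \det (P *m Q)^T = 0.
  rewrite det_tr; apply/eqP; apply: contraT => dN0.
  have /row_freeP : row_free (P *m Q).
    by rewrite row_free_unit unitmxE unitfE.
  move=> /row_freeP; rewrite /row_free => /eqP rE.
  have := leq_trans (mxrankM_maxl P Q) (rank_leq_col P).
  by rewrite rE ltnn.
rewrite -[RHS]det0 linear_sum; apply: eq_bigr => s _.
rewrite !linearZ /= big_ord_recl; congr (_ * _); rewrite mulrC; congr (_ * _).
  rewrite !mxE (bigD1 l) //= big1 ?addr0 => [|k kl].
    by rewrite !mxE unlift_none eqxx mulr1.
  by rewrite !mxE unlift_none (negbTE kl) mulr0.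
apply: eq_bigr => i _; rewrite !mxE /B.
rewrite {1}(coord_vbasis (memvf (v (s (lift ord0 i))))) linear_sumr.
by apply: eq_bigr => k _; rewrite !mxE liftK linearZr_LR.
Qed.

(** * Symmetric matrices of order two *)

Section DotProduct.
Variable K : fieldType.

Definition dot2 (u v : 'rV[K]_2) : K := u 0 0 * v 0 0 + u 0 1 * v 0 1.

Fact dot2_bilinear : bilinear_for *%R (idfun \; *%R) dot2.
Proof. by split=> [w|w] a u v; rewrite /dot2 /= !mxE; ring. Qed.

HB.instance Definition _ := bilinear_isBilinear.Build K 'rV[K]_2 'rV[K]_2 K
  ( *%R) (idfun \; *%R) dot2 dot2_bilinear.

Fact dot2_sym u v : dot2 u v = (-1) ^+ false * idfun (dot2 v u).
Proof. by rewrite /dot2 /=; ring. Qed.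

HB.instance Definition _ :=
  isHermitianSesquilinear.Build K 'rV[K]_2 false idfun dot2 dot2_sym.

Lemma dot2_nondegenerate : nondegenerate_form (dot2 : {symmetric 'rV[K]_2}).
Proof.
move=> u u0; apply/rowP => j; rewrite mxE.
have := u0 (delta_mx 0 j); rewrite /= /dot2 !mxE /=.
case: j => -[|[|//]] ltj; rewrite -!val_eqE /= ?mulr1 ?mulr0 ?addr0 ?add0r => <-;
  by congr (u 0 _); apply: val_inj.
Qed.

Variable char_neq2 : 2%N \notin [pchar K].
Local Notation B := (form_alg (dot2 : {symmetric 'rV[K]_2})).
Local Notation J := (sym2_alg char_neq2).

Definition sym2_mx (u : B) : 'M[K]_2 := u.1 *: (delta_mx 0 0 + delta_mx 1 1) +
  (u.2 0 0 *: (delta_mx 0 0 - delta_mx 1 1) +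
   u.2 0 1 *: (delta_mx 0 1 + delta_mx 1 0)).

Lemma sym2_mxE u : sym2_mx u = \matrix_(i, j)
  if i == j then if i == 0 then u.1 + u.2 0 0 else u.1 - u.2 0 0 else u.2 0 1.
Proof.
apply/matrixP=> i j; rewrite !mxE.
by move: i j => [[|[|//]] ?] [[|[|//]] ?]; rewrite -!val_eqE /=; ring.
Qed.

Fact sym2_mx_sym u : sym2_mx u \in @symmx2 K.
Proof.
rewrite sym2_mxE inE; apply/eqP/matrixP=> i j; rewrite !mxE eq_sym.
by case: eqP => // ->.
Qed.

Definition sym2_embed (u : B) : J := exist [eta mem (@symmx2 K)] _ (sym2_mx_sym u).

Fact sym2_embed_linear : linear sym2_embed.
Proof.
move=> a u v; apply: val_inj; rewrite /= !sym2_mxE; apply/matrixP=> i j.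
rewrite !mxE /= ?mxE; case: eqP => _; [case: eqP => _|];
  by rewrite /= /GRing.scale /=; ring.
Qed.

HB.instance Definition _ :=
  GRing.isLinear.Build K B J _ sym2_embed sym2_embed_linear.

Lemma sym2_embed_hom : jordan_hom sym2_embed.
Proof.
have two_neq0 : 2 != 0 :> K by move: char_neq2; rewrite inE.
split=> [|u v]; apply: val_inj; rewrite /= !sym2_mxE; apply/matrixP=> i j.
  by rewrite !mxE /= addr0 subr0; case: eqP => //; case: eqP.
rewrite !(mxE, big_ord_recl, big_ord0) /= /dot2.
by move: i j => [[|[|//]] ?] [[|[|//]] ?]; rewrite -!val_eqE /=; field.
Qed.

Lemma sym2_embed_inj u : sym2_embed u = 0 -> u = 0.
Proof.
have two_neq0 : 2 != 0 :> K by move: char_neq2; rewrite inE.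
move=> /(congr1 val) /=; rewrite sym2_mxE => /matrixP M0.
have := M0 0 0; have := M0 1 1; have := M0 0 1; rewrite !mxE /= => u01 u11 u00.
have u10 : u.1 = 0.
  apply: (mulfI two_neq0); transitivity ((u.1 + u.2 0 0) + (u.1 - u.2 0 0)); first ring.
  by rewrite u00 u11; ring.
move: u00; rewrite u10 add0r => u00.
apply: injective_projections => //=; apply/rowP => j; rewrite mxE.
by case: j => -[|[|//]] ltj; [rewrite -[RHS]u00 | rewrite -[RHS]u01];
  congr (u.2 0 _); apply: val_inj.
Qed.

Lemma sym2_embed_graded a u :
  scalar_grading (dot2 : {symmetric 'rV[K]_2}) a u ->
  sym2_scalar_grading char_neq2 a (sym2_embed u).
Proof.
have s0 : (delta_mx 0 0 + delta_mx 1 1 : 'M[K]_2) \in @symmx2 K.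
  by rewrite inE linearD /= !trmx_delta.
have s1 : (delta_mx 0 0 - delta_mx 1 1 : 'M[K]_2) \in @symmx2 K.
  by rewrite inE linearB /= !trmx_delta.
have s2 : (delta_mx 0 1 + delta_mx 1 0 : 'M[K]_2) \in @symmx2 K.
  by rewrite inE linearD /= !trmx_delta addrC.
case: a => /= u0.
  have -> : sym2_embed u = u.2 0 0 *: (exist [eta mem (@symmx2 K)] _ s1 : J) +
                           u.2 0 1 *: (exist [eta mem (@symmx2 K)] _ s2 : J).
    by apply: val_inj; rewrite /= /sym2_mx u0 scale0r add0r.
  apply: (subspaceD (lspan_subspace _)); apply: (subspaceZ _ (lspan_subspace _)).
    by apply: sub_lspan; left.
  by apply: sub_lspan; right.
have -> : sym2_embed u = (u.1 : K) *: (exist [eta mem (@symmx2 K)] _ s0 : J).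
  by apply: val_inj; rewrite /= /sym2_mx u0 !mxE !scale0r !addr0.
by apply: (subspaceZ _ (lspan_subspace _)); exact: sub_lspan.
Qed.

(** The algebra of the dot product embeds in the algebra of symmetric matrices,
    and the embedding respects the gradings. *)
Lemma sym2_identities_dot2 :
  graded_identities (sym2_scalar_grading char_neq2) `<=`
  graded_identities (scalar_grading (dot2 : {symmetric 'rV[K]_2})).
Proof.
move=> f Jf rho Grho; apply: sym2_embed_inj.
have E := fj_eval_unique (f := sym2_embed \o fj_eval rho)
  (rho := sym2_embed \o rho).
rewrite -[LHS]/((sym2_embed \o fj_eval rho) f) E.
- by apply: Jf => x; exact: sym2_embed_graded.
- split=> [|u v] /=; first by rewrite fj_eval1 sym2_embed_hom.1.
  by rewrite fj_evalM sym2_embed_hom.2.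
- by move=> x /=; rewrite fj_eval_gen.
Qed.

End DotProduct.

Lemma sym2_poly_gpoly (K : fieldType) : sym2_poly K = gpoly K 2.
Proof.
apply: eq_bigr => s _; congr (_ *: _).
rewrite enum_ordSl enum_ordSl /= enum_ord0 /=.
by do 2?[congr (_ ** (_ ** _)) => //]; rewrite ?addn0 //; congr (zvar K (s _)); apply: val_inj.
Qed.

(** * Bases of identities *)

Section FormTIdeals.
Variables (K : fieldType) (Kinf : infinite_set [set: K]).
Variable char_neq2 : 2%N \notin [pchar K].

Lemma T_ideal_generated (S : set (JX K)) : graded_T_ideal (graded_T_ideal_generated S).
Proof.
split; first split; first split.
- by move=> I [[[[I0 _] _] _] _].
- by move=> a u v Su Sv I IS; have [[[_ IP] _] _] := IS.1; apply: IP; [exact: Su | exact: Sv].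
- by move=> u v Su I IS; apply: IS.1.1.2; exact: Su.
- by move=> f fG u Su I IS; apply: IS.1.2 => //; exact: Su.
Qed.

Lemma T_ideal_generated_min (S I : set (JX K)) :
  graded_T_ideal I -> S `<=` I -> graded_T_ideal_generated S `<=` I.
Proof. by move=> TI SI u; apply. Qed.

Lemma sub_T_ideal_generated (S : set (JX K)) : S `<=` graded_T_ideal_generated S.
Proof. by move=> u Su I [_]; apply. Qed.

Lemma infinite_form_identities (V : lmodType K) (b : {symmetric V}) :
  infinite_dimensional V -> nondegenerate_form b ->
  graded_identities (scalar_grading b) =
  graded_T_ideal_generated (y_associators K).
Proof.
move=> Vinf b_nondeg; apply/seteqP; split; last first.
  apply: T_ideal_generated_min; first exact: form_identities_T_ideal.
  exact: y_associators_form.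
move=> f Idf; have TI := T_ideal_generated (y_associators K).
have [s [c [us sN Ifs]]] :=
  normal_reduction char_neq2 TI (sub_T_ideal_generated (S := _)) f.
(* With that many colours all the pairs of a word can get different ones. *)
pose n := (\max_(w <- s) size w.2)%N.
have [e [e_orth e_neq0]] : exists e : nat -> V,
    (forall i j, (i < n)%N -> (j < n)%N -> i != j -> b (e i) (e j) = 0) /\
    (forall i, (i < n)%N -> b (e i) (e i) != 0).
  by apply: orthogonal_family => // s' _ s'T; apply: Vinf; exists s'.
apply: (form_identity_mem Kinf e_orth e_neq0 _ Idf us _ Ifs).
  apply: T_ideal_generated_min; first exact: form_identities_T_ideal.
  exact: y_associators_form.
move=> w ws; split; first exact: sN.
by exists (index^~ w.2); apply: size_colouring;
  exact: (leq_bigmax_seq w ws).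
Qed.

Lemma finite_form_identities (n : nat) (V : vectType K) (b : {symmetric V}) :
  \dim {:V} = n -> nondegenerate_form b ->
  graded_identities (scalar_grading b) =
  graded_T_ideal_generated (y_associators K `|` [set gpoly K n]).
Proof.
move=> dimV b_nondeg; set S := _ `|` _.
have TI := T_ideal_generated S.
have SI : graded_T_ideal_generated S `<=` graded_identities (scalar_grading b).
  apply: T_ideal_generated_min; first exact: form_identities_T_ideal.
  move=> u [|->]; first exact: y_associators_form.
  by rewrite -dimV; exact: gpoly_form_identity.
apply/seteqP; split=> // f Idf.
have yI : y_associators K `<=` graded_T_ideal_generated S.
  by move=> u yu; apply: sub_T_ideal_generated; left.
have gI : graded_T_ideal_generated S (gpoly K n).
  by apply: sub_T_ideal_generated; right.
have [s [c [us sP Ifs]]] := colourable_reduction char_neq2 TI yI f gI.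
have [e [e_orth e_neq0]] : exists e : nat -> V,
    (forall i j, (i < n)%N -> (j < n)%N -> i != j -> b (e i) (e j) = 0) /\
    (forall i, (i < n)%N -> b (e i) (e i) != 0).
  apply: orthogonal_family => // s'; rewrite -dimV; exact: vect_no_small_span.
exact: (form_identity_mem Kinf e_orth e_neq0 SI Idf us sP Ifs).
Qed.

End FormTIdeals.

Theorem corollary21 (K : fieldType) (Kinf : infinite_set [set: K])
    (char_neq2 : 2%N \notin [pchar K]) :
  [/\ forall (V : lmodType K) (b : {symmetric V}),
        infinite_dimensional V -> nondegenerate_form b ->
        graded_identities (scalar_grading b) =
        graded_T_ideal_generated (y_associators K),
      forall (n : nat) (V : vectType K) (b : {symmetric V}),
        (1 <= n)%N -> \dim {:V} = n -> nondegenerate_form b ->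
        graded_identities (scalar_grading b) =
        graded_T_ideal_generated (y_associators K `|` [set gpoly K n])
    & graded_identities (sym2_scalar_grading char_neq2) `<=`
        graded_T_ideal_generated (y_associators K `|` [set sym2_poly K])].
Proof.
split.
- by move=> V b; exact: infinite_form_identities.
- by move=> n V b _; exact: finite_form_identities.
- move=> f /sym2_identities_dot2; rewrite sym2_poly_gpoly.
  rewrite (finite_form_identities Kinf char_neq2 (n := 2)) //.
    by rewrite dimvf /dim /= mul1n.
  exact: dot2_nondegenerate.
Qed.
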